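(* Let $n\ge 1$ and suppose $\mathbf X\sim ELL_n(\boldsymbol\mu,\mathbf\Sigma,g)$, i.e. $\mathbf X$ is an $n$-dimensional elliptical random vector with location vector $\boldsymbol\mu\in\mathbb R^n$, positive definite dispersion matrix $\mathbf\Sigma\in\mathbb R^{n\times n}$ and density generator $g$. Then the characteristic function $\psi_{\mathbf X}(\mathbf t)=E(e^{i\mathbf t'\mathbf X})$ of $\mathbf X$ is given by $$\psi_{\mathbf X}(\mathbf t)=e^{i\mathbf t'\boldsymbol\mu}\,\phi(\mathbf t'\mathbf\Sigma\mathbf t),\qquad \mathbf t\in\mathbb R^n,$$ where $\phi$ is the real-valued function on $[0,\infty)$ defined by $$\phi(u^2)=c_n(2\pi)^{\frac n2}\,u^{-\frac{n-2}{2}}\int_0^\infty r^{\frac n2}J_{\frac{n-2}{2}}(ru)\,g(r^2)\,dr,\qquad u\ge 0,$$ the value at $u=0$ being understood as the limit of the right-hand side as $u\to0^+$, and where $$c_n=\frac{\Gamma(\frac n2)}{\pi^{n/2}}\left(\int_0^\infty z^{\frac n2-1}g(z)\,dz\right)^{-1}.$$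
   Context: A prime or superscript $T$ denotes transpose. $\mathbf X\sim ELL_n(\boldsymbol\mu,\mathbf\Sigma,g)$ means that $\mathbf X$ is a random vector in $\mathbb R^n$ with probability density $$f(\mathbf x)=c_n|\mathbf\Sigma|^{-1/2}\,g\big((\mathbf x-\boldsymbol\mu)^T\mathbf\Sigma^{-1}(\mathbf x-\boldsymbol\mu)\big),\qquad \mathbf x\in\mathbb R^n,$$ where $|\mathbf\Sigma|$ is the determinant of $\mathbf\Sigma$, the density generator $g:[0,\infty)\to[0,\infty)$ is a (measurable) function with $0<\int_0^\infty z^{\frac n2-1}g(z)\,dz<\infty$, and $c_n=\frac{\Gamma(n/2)}{\pi^{n/2}}\big(\int_0^\infty z^{\frac n2-1}g(z)\,dz\big)^{-1}$ is the normalizing constant. $J_\nu$ is the Bessel function of the first kind of order $\nu$: $J_\nu(x)=\sum_{k=0}^\infty(-1)^k\frac{1}{k!\,\Gamma(\nu+k+1)}\left(\frac x2\right)^{\nu+2k}$. *)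

(* Defs.v *)
From HB Require Import structures.
From mathcomp Require Import all_boot all_order all_algebra.
From mathcomp Require Import all_classical all_reals all_analysis.
From mathcomp Require Import complex.

Set Implicit Arguments.
Unset Strict Implicit.
Unset Printing Implicit Defensive.

Import Order.TTheory GRing.Theory Num.Theory.
Import numFieldNormedType.Exports.

Local Open Scope classical_set_scope.
Local Open Scope ring_scope.

Section LebesgueRn.
Context {R : realType}.

(* R^n is the measurable type n.-tuple R, whose sigma-algebra (generated by   *)
(* the coordinates) is the Borel one. Its Lebesgue measure is built by        *)
(* recursion on n, as the image of lambda_1 (x) lambda_n under cons.          *)

Definition tcons n (p : measurableTypeR R * n.-tuple R) : n.+1.-tuple R :=
  [tuple of (p.1 : R) :: p.2].

Lemma measurable_tcons n : measurable_fun setT (@tcons n).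
Proof.
by apply: (@measurable_cons _ _ _ R);
  [exact: measurable_fst|exact: measurable_snd].
Qed.

Section step.
Variables (n : nat) (m : {sigma_finite_measure set (n.-tuple R) -> \bar R}).

Definition lebesgue_cons : set (n.+1.-tuple R) -> \bar R :=
  pushforward (lebesgue_measure \x m)%E (@tcons n).

Let img : {measure set (n.+1.-tuple R) -> \bar R} :=
  measure_function_pushforward__canonical__measure_function_Measure
    (lebesgue_measure \x m)%E (@measurable_tcons n).

Let lebesgue_cons0 : lebesgue_cons set0 = 0%E.
Proof. exact: (measure0 img). Qed.

Let lebesgue_cons_ge0 A : (0 <= lebesgue_cons A)%E.
Proof. exact: (measure_ge0 img). Qed.

Let lebesgue_cons_sigma_additive : semi_sigma_additive lebesgue_cons.
Proof. exact: (@measure_semi_sigma_additive _ _ _ img). Qed.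

HB.instance Definition _ := isMeasure.Build _ _ _ lebesgue_cons
  lebesgue_cons0 lebesgue_cons_ge0 lebesgue_cons_sigma_additive.

Let lebesgue_cons_sigma_finite : sigma_finite setT lebesgue_cons.
Proof.
have /sigma_finiteP[F [FT ndF Ffin]] := sigma_finiteT (@lebesgue_measure R).
have /sigma_finiteP[G [GT ndG Gfin]] := sigma_finiteT m.
pose uncons (x : n.+1.-tuple R) : measurableTypeR R * n.-tuple R :=
  (thead x, [tuple of behead x]).
have tconsK p : uncons (tcons p) = p.
  by case: p => a t; rewrite /uncons /tcons theadE; congr pair; apply: val_inj.
have muncons : measurable_fun setT uncons.
  by apply/measurable_fun_pairP; split;
    [exact: measurable_tnth|exact: measurable_behead].
exists (fun k => uncons @^-1` (F k `*` G k)).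
  rewrite -preimage_bigcup; apply/seteqP; split=> // x _; rewrite /preimage/=.
  have : setT (uncons x).1 by []. rewrite FT => -[i _ Fi].
  have : setT (uncons x).2 by []. rewrite GT => -[j _ Gj].
  exists (maxn i j) => //; split.
    by move: Fi; exact/subsetPset/ndF/leq_maxl.
  by move: Gj; exact/subsetPset/ndG/leq_maxr.
move=> k; have [mF finF] := Ffin k; have [mG finG] := Gfin k.
have mFG : measurable (F k `*` G k) by exact: measurableX.
split; first by rewrite -[X in measurable X]setTI; exact: muncons.
rewrite /lebesgue_cons /pushforward -comp_preimage.
rewrite (_ : uncons \o @tcons n = id); last exact/funext.
by rewrite preimage_id product_measure1E// lte_mul_pinfty// ge0_fin_numE.
Qed.

HB.instance Definition _ := Measure_isSigmaFinite.Build _ _ _ lebesgue_cons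
  lebesgue_cons_sigma_finite.

End step.

Fixpoint lebesgue_Rn n : {sigma_finite_measure set (n.-tuple R) -> \bar R} :=
  match n with
  | 0%N => [the {sigma_finite_measure set (0.-tuple R) -> \bar R} of
              dirac ([tuple] : 0.-tuple R)]
  | n'.+1 => [the {sigma_finite_measure set (n'.+1.-tuple R) -> \bar R} of
              lebesgue_cons (lebesgue_Rn n')]
  end.

(* The measure of a box is the product of the measures of its sides. *)
Lemma lebesgue_Rn_box n (A : 'I_n -> set R) : (forall i, measurable (A i)) ->
  lebesgue_Rn n [set x | forall i, A i (tnth x i)] =
  (\prod_(i < n) (lebesgue_measure (A i) : \bar R))%E.
Proof.
elim: n A => [A mA|n IH A mA].
  rewrite big_ord0 /= diracE mem_set//= => i; by case: i.
rewrite big_ord_recl -IH//= /lebesgue_cons /pushforward.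
rewrite -product_measure1E//; first last.
  rewrite (_ : mkset _ = \bigcap_(i in setT)
      ((fun x : n.-tuple R => tnth x i) @^-1` A (lift ord0 i))); last first.
    by apply/seteqP; split=> [x Ax i _|x Ax i]; [exact: Ax|exact: (Ax i I)].
  apply: fin_bigcap_measurable => [|i _]; first exact: finite_finset.
  rewrite -[X in measurable X]setTI; exact: measurable_tnth.
  exact: mA.
congr (product_measure1 _ _ _); apply/seteqP; split=> -[a x] /=.
  move=> Ax; split; first exact: (Ax ord0).
  by move=> i; have := Ax (lift ord0 i); rewrite tnthS.
by move=> [Aa Ax] i; case: (unliftP ord0 i) => [j|] ->; rewrite ?tnthS.
Qed.

End LebesgueRn.

Section SpecialFunctions.
Context {R : realType}.

(* Meaningful for x > 0 only, where the integral converges. *)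
Definition gamma_fun (x : R) : R :=
  \int[lebesgue_measure]_(t in `[0, +oo[) (t `^ (x - 1) * expR (- t)).

Definition besselJ (nu x : R) : R :=
  limn (series (fun k : nat =>
    (-1) ^+ k / (k`!%:R * gamma_fun (nu + k%:R + 1))
    * (x / 2) `^ (nu + 2 * k%:R))).

Local Open Scope complex_scope.

Definition cexp (z : R[i]) : R[i] :=
  expR (complex.Re z) * cos (complex.Im z)
  +i* (expR (complex.Re z) * sin (complex.Im z)).

End SpecialFunctions.

Section Elliptical.
Context {R : realType}.

Definition colv n (x : n.-tuple R) : 'cV[R]_n := \col_i tnth x i.

Definition posdefmx n (S : 'M[R]_n) : Prop :=
  S^T = S /\ forall x : 'cV[R]_n, x != 0 -> 0 < (x^T *m S *m x) 0 0.

(* Only the values of g on [0, +oo[ matter. Powers of 0 follow the convention *)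
(* of powR; this concerns a negligible set in every integral below.           *)
Definition density_generator (n : nat) (g : R -> R) : Prop :=
  [/\ forall z, 0 <= z -> 0 <= g z,
      measurable_fun (`[0, +oo[ : set R) g &
      (0 < \int[lebesgue_measure]_(z in `[0%R, +oo[)
             (z `^ (n%:R / 2 - 1) * g z)%:E < +oo)%E].

Definition ell_norm_const (n : nat) (g : R -> R) : R :=
  gamma_fun (n%:R / 2) / pi `^ (n%:R / 2) *
  (\int[lebesgue_measure]_(z in `[0, +oo[) (z `^ (n%:R / 2 - 1) * g z))^-1.

Definition ell_density n (mu : 'cV[R]_n) (S : 'M[R]_n) (g : R -> R)
    (x : 'cV[R]_n) : R :=
  ell_norm_const n g * (\det S) `^ (- 2^-1) *
  g (((x - mu)^T *m invmx S *m (x - mu)) 0 0).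

Definition elliptical d (T : measurableType d) (P : probability T R) n
    (X : {RV P >-> n.-tuple R}) (mu : 'cV[R]_n) (S : 'M[R]_n) (g : R -> R) :=
  [/\ posdefmx S, density_generator n g &
      forall A : set (n.-tuple R), measurable A ->
        distribution P X A =
        (\int[lebesgue_Rn n]_(x in A) (ell_density mu S g (colv x))%:E)%E].

Local Open Scope complex_scope.

Definition cexpectation d (T : measurableType d) (P : probability T R)
    (Z : T -> R[i]) : R[i] :=
  fine 'E_P[fun w => complex.Re (Z w)] +i* fine 'E_P[fun w => complex.Im (Z w)].

Definition charfun d (T : measurableType d) (P : probability T R) n
    (X : {RV P >-> n.-tuple R}) (t : 'cV[R]_n) : R[i] :=
  cexpectation P (fun w => cexp (((t^T *m colv (X w)) 0 0)*i)).

Definition ell_phi_integrand (n : nat) (g : R -> R) (u r : R) : R :=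
  r `^ (n%:R / 2) * besselJ ((n%:R - 2) / 2) (r * u) * g (r ^+ 2).

(* The right-hand side of the formula for phi(u^2), u > 0. *)
Definition ell_phi_rhs (n : nat) (g : R -> R) (u : R) : R :=
  ell_norm_const n g * (2 * pi) `^ (n%:R / 2) * u `^ (- ((n%:R - 2) / 2)) *
  \int[lebesgue_measure]_(r in `[0, +oo[) ell_phi_integrand n g u r.

Definition ell_phi (n : nat) (g : R -> R) (v : R) : R :=
  if 0 < v then ell_phi_rhs n g (Num.sqrt v)
  else lim (ell_phi_rhs n g u @[u --> 0^'+]).

End Elliptical.

(* Main.v *)
Require Import Defs.
From HB Require Import structures.
From mathcomp Require Import all_boot all_order all_algebra.
From mathcomp Require Import all_classical all_reals all_analysis.
From mathcomp Require Import measurable_realfun complex ring lra.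

Set Implicit Arguments.
Unset Strict Implicit.
Unset Printing Implicit Defensive.

Import Order.TTheory GRing.Theory Num.Theory.
Import numFieldNormedType.Exports.

Local Open Scope classical_set_scope.
Local Open Scope ring_scope.

(** Write m for the dimension, q(x) = x' S^-1 x, N = sqrt q, l(x) = t'x,
    u^2 = t'St and nu = (m - 2) / 2. The proof uses no rotation, no coordinates
    on the sphere and no determinant: the only changes of variables in R^m are
    translations and dilations.

    Since N is homogeneous of degree 1 and l^(2k) of degree 2k, the integral of
    l^(2k) over {N <= r} is a constant times r^(m + 2k). Hence, for f >= 0,
      int f(N) l^(2k) dx = a_k int_0^oo f(r) r^(m - 1 + 2k) dr
    with one constant a_k for all f ([integral_polar_lform]). These constants
    are found by testing on f(r) = exp (- r^2). Completing the square, which is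
    a translation, gives
      int exp (- q + s l) dx = G exp (s^2 u^2 / 4),  where G = int exp (- q) dx,
    and the comparison of the coefficients of s^(2k) gives
      a_k / (2k)! = 2 G (u^2 / 4)^k / (k! Gamma (m/2 + k)),
    the coefficients of the Bessel series ([angular_momentE]).

    Summing the cosine series, one gets
      int f(N) cos l dx = int_0^oo f(r) r^(m - 1) K(r) dr,
      K(r) = 2 G (r u / 2)^(- nu) J_nu (r u),
    for f with bounded support ([integral_polar_cos_bounded]). Testing this
    formula on the sets where |K| exceeds its value K(0) shows that these sets
    are negligible ([ae_radial_kernel_le]), and dominated convergence extends
    the formula to all f with int f r^(m - 1) finite ([integral_polar_cos]).

    For f the radial profile of the density of X - mu, the left-hand side is
    the characteristic function of X - mu at t, the sine part being zero by the
    reflection x -> - x. The constants agree because the density has mass one: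
    this forces (det S)^(-1/2) G = pi^(m/2) ([gauss_mass_norm]), a value of the
    Gaussian integral that is thus read off rather than computed. The limit at
    u -> 0+ is dominated convergence for cos (u l), and equals 1. *)

(** * Measures given by a density *)
Section Density.
Local Open Scope ereal_scope.
Context d (T : measurableType d) {R : realType}.

Import HBNNSimple.

(** By monotone convergence and linearity it suffices to take f the indicator
    of a measurable set, where the equality is the hypothesis on nu. *)
Lemma ge0_integral_density (mu nu : {measure set T -> \bar R}) (h : T -> R)
    (f : T -> \bar R) :
  (forall x, (0 <= h x)%R) -> measurable_fun setT h ->
  (forall A, measurable A -> nu A = \int[mu]_(x in A) (h x)%:E) ->
  (forall x, 0 <= f x) -> measurable_fun setT f ->
  \int[nu]_x f x = \int[mu]_x (f x * (h x)%:E).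
Proof.
move=> h0 mh nuE f0 mf; pose s := nnsfun_approx measurableT mf.
have fs x : f x = lim ((s n x)%:E @[n --> \oo]).
  by apply/esym/cvg_lim => //; exact: cvg_nnsfun_approx.
have fhs x : f x * (h x)%:E = lim ((s n x)%:E * (h x)%:E @[n --> \oo]).
  apply/esym/cvg_lim => //; apply: cvgeZr => //.
  exact: cvg_nnsfun_approx.
under eq_integral do rewrite fs.
under [RHS]eq_integral do rewrite fhs.
have ms n : measurable_fun setT (EFin \o s n) by exact/measurable_EFinP.
have mEh : measurable_fun setT (EFin \o h) by exact/measurable_EFinP.
have nds x : {homo (fun n => (s n x)%:E) : a b / (a <= b)%N >-> a <= b}.
  by move=> a b ab; rewrite lee_fin; exact/lefP/nd_nnsfun_approx.
have s0 n x : 0 <= (s n x)%:E by rewrite lee_fin.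
rewrite monotone_convergence//.
rewrite [in RHS]monotone_convergence//; last 3 first.
- by move=> n; apply: emeasurable_funM; [exact: ms|exact: mEh].
- by move=> n x _; rewrite mule_ge0 ?lee_fin.
- by move=> x _ a b ab; rewrite lee_wpmul2r ?lee_fin//; exact: nds.
apply/congr_lim/funext => n.
have mind r : measurable_fun setT (fun x => (r * \1_(s n @^-1` [set r]) x)%:E).
  by apply/measurable_EFinP; exact: measurable_funM.
under eq_integral do rewrite fimfunE -fsumEFin//.
rewrite ge0_integral_fsum//; last by move=> r x _; exact: nnfun_muleindic_ge0.
under [RHS]eq_integral => x _.
  rewrite fimfunE -fsumEFin// ge0_mule_fsuml; last first.
    by move=> r; exact: nnfun_muleindic_ge0.
  over.
rewrite ge0_integral_fsum//; last 2 first.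
- by move=> r; exact: emeasurable_funM.
- move=> r x _; apply: mule_ge0; last by rewrite lee_fin.
  exact: nnfun_muleindic_ge0.
apply: eq_fsbigr => r /set_mem[x _ <-].
have mA : measurable (s n @^-1` [set s n x]) by [].
rewrite integralZl_indic_nnsfun// integral_indic// setIT nuE//.
under [RHS]eq_integral do rewrite EFinM -muleA.
rewrite ge0_integralZl//.
- congr (_ * _); rewrite [LHS]integral_mkcond; apply: eq_integral => y _.
  by rewrite patchE indicE; case: ifPn => _; rewrite ?mul0e ?mul1e.
- by apply: emeasurable_funM => //; exact/measurable_EFinP.
- by move=> y _; rewrite mule_ge0// lee_fin.
- by rewrite lee_fin.
Qed.

End Density.

(** * Translations and dilations of Lebesgue measure *)
Section Affine1.
Local Open Scope ereal_scope.
Context {R : realType}.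

Lemma measurable_affine (c b : R) :
  measurable_fun setT (fun x : R => (c * x + b)%R).
Proof. by apply: measurable_funD => //; exact: measurable_funM. Qed.

(** Both sides are measures in A, and they agree on half-open intervals. *)
Lemma lebesgue_measure_affine (c b : R) (A : set R) : c != 0%R ->
  measurable A ->
  lebesgue_measure A = (`|c|)%:E *
    lebesgue_measure ((fun x : R => (c * x + b)%R) @^-1` A).
Proof.
move=> c0 mA.
pose img : {measure set (measurableTypeR R) -> \bar R} :=
  measure_function_pushforward__canonical__measure_function_Measure
    (@lebesgue_measure R) (measurable_affine c b :
      measurable_fun setT (_ : measurableTypeR R -> measurableTypeR R)).
pose m := mscale (NngNum (normr_ge0 c)) img.
have : lebesgue_measure A = m A; last by [].
apply: lebesgue_measure_unique => // _ [[u v]] _ <-.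
transitivity ((`|c|)%:E *
  lebesgue_measure ((fun x : R => (c * x + b)%R) @^-1` `]u, v]%classic))%E; last by [].
have Ec a : (c * ((a - b) / c) + b = a)%R by rewrite mulrC divfK// subrK.
have [cp|cn|/eqP] := ltgtP c 0%R; last by rewrite (negbTE c0).
- rewrite (_ : _ @^-1` _ = `[(v - b) / c, (u - b) / c[%classic)%R; last first.
    apply/seteqP; split => x /=; rewrite !in_itv/=.
      by rewrite ler_ndivrMr// ltr_ndivlMr// lerBrDr ltrBlDr mulrC andbC.
    by rewrite ler_ndivrMr// ltr_ndivlMr// lerBrDr ltrBlDr mulrC andbC.
  rewrite !lebesgue_measure_itv/= !lte_fin ltr_ndivrMr// divfK// ltrBlDr subrK.
  case: ifPn => // uv; last by rewrite mule0.
  by rewrite -EFinD -EFinM ltr0_norm//; congr EFin; field.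
- rewrite (_ : _ @^-1` _ = `](u - b) / c, (v - b) / c]%classic)%R; last first.
    apply/seteqP; split => x /=; rewrite !in_itv/=.
      by rewrite ler_pdivlMr// ltr_pdivrMr// lerBrDr ltrBlDr mulrC.
    by rewrite ler_pdivlMr// ltr_pdivrMr// lerBrDr ltrBlDr mulrC.
  rewrite !lebesgue_measure_itv/= !lte_fin ltr_pdivrMr// divfK// ltrBlDr subrK.
  case: ifPn => // uv; last by rewrite mule0.
  by rewrite -EFinD -EFinM gtr0_norm//; congr EFin; field.
Qed.

Lemma ge0_integral_affine (c b : R) (f : R -> \bar R) : c != 0%R ->
  (forall x, 0 <= f x) -> measurable_fun setT f ->
  \int[lebesgue_measure]_x f x =
  (`|c|)%:E * \int[lebesgue_measure]_x f (c * x + b)%R.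
Proof.
move=> c0 f0 mf.
pose img : {measure set (measurableTypeR R) -> \bar R} :=
  measure_function_pushforward__canonical__measure_function_Measure
    (@lebesgue_measure R) (measurable_affine c b :
      measurable_fun setT (_ : measurableTypeR R -> measurableTypeR R)).
pose m := mscale (NngNum (normr_ge0 c)) img.
transitivity (\int[m]_x f x).
  apply: eq_measure_integral => A mA _.
  exact: (lebesgue_measure_affine b).
rewrite ge0_integral_mscale//=; congr (_ * _).
rewrite (ge0_integral_pushforward (measurable_affine c b :
  measurable_fun setT (_ : measurableTypeR R -> measurableTypeR R)))//.
Qed.

End Affine1.

Section LebesgueRnAffine.
Local Open Scope ereal_scope.
Context {R : realType}.

(** The recursive definition of the measure, read through Tonelli. *)
Lemma ge0_integral_lebesgue_RnS n (f : n.+1.-tuple R -> \bar R) :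
  (forall x, 0 <= f x) -> measurable_fun setT f ->
  \int[lebesgue_Rn n.+1]_x f x =
  \int[lebesgue_measure]_a \int[lebesgue_Rn n]_x f (tcons (a, x)).
Proof.
move=> f0 mf.
rewrite (@ge0_integral_pushforward _ _ _ _ _ _ (@measurable_tcons R n)
  (lebesgue_measure \x lebesgue_Rn n)%E setT f)//.
rewrite preimage_setT (fubini_tonelli1 (f \o @tcons R n))//.
- apply: measurableT_comp => //; exact: measurable_tcons.
- by move=> x; exact: f0.
Qed.

Definition taffine n (c : R) (v x : n.-tuple R) : n.-tuple R :=
  [tuple (c * tnth x i + tnth v i)%R | i < n].

Lemma measurable_taffine n c (v : n.-tuple R) :
  measurable_fun setT (taffine c v).
Proof.
apply/measurable_fun_tnthP => i.
rewrite (_ : _ \o _ = fun x => (c * tnth x i + tnth v i)%R); last first.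
  by apply/funext => x; rewrite /= tnth_mktuple.
by apply: measurable_funD => //; apply: measurable_funM => //;
  exact: measurable_tnth.
Qed.

Lemma taffine_tcons n c (a b : R) (v x : n.-tuple R) :
  taffine c (tcons (b, v)) (tcons (a, x)) =
  tcons ((c * a + b)%R, taffine c v x).
Proof.
apply: eq_from_tnth => i; rewrite tnth_mktuple.
by case: (unliftP ord0 i) => [j|] ->; rewrite ?tnth0 ?tnthS ?tnth_mktuple.
Qed.

Lemma tconsP n (v : n.+1.-tuple R) : exists a x, v = tcons (a, x).
Proof.
exists (thead v), [tuple of behead v]; apply: val_inj => /=.
by case/tupleP: v => a x; rewrite theadE.
Qed.

(** By induction on the dimension, each coordinate contributing one factor |c|.
    Translations (c = 1), dilations (v = 0) and the reflection (c = -1) are the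
    only changes of variables in R^n that the theorem requires. *)
Lemma ge0_integral_taffine n (c : R) (v : n.-tuple R)
    (f : n.-tuple R -> \bar R) : c != 0%R ->
  (forall x, 0 <= f x) -> measurable_fun setT f ->
  \int[lebesgue_Rn n]_x f x =
  (`|c| ^+ n)%:E * \int[lebesgue_Rn n]_x f (taffine c v x).
Proof.
move=> c0; elim: n => [|n IH] in v f *.
  move=> f0 mf; rewrite expr0 mul1e; apply: eq_integral => x _.
  by rewrite [x]tuple0 [taffine _ _ _]tuple0.
have [b [w ->]] := tconsP v => f0 mf.
have mtc : measurable_fun setT (f \o @tcons R n).
  by apply: measurableT_comp => //; exact: measurable_tcons.
have mf2 : measurable_fun setT
    (fun p : measurableTypeR R * n.-tuple R => f (tcons (p.1, taffine c w p.2))).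
  apply: (measurableT_comp mtc
    (g := fun p : measurableTypeR R * n.-tuple R => (p.1, taffine c w p.2))).
  apply/measurable_fun_pairP; split; first exact: measurable_fst.
  exact: measurableT_comp (measurable_taffine c w) measurable_snd.
rewrite ge0_integral_lebesgue_RnS//.
under eq_integral => a _.
  rewrite (IH w (fun x => f (tcons (a, x))))//; last first.
    exact: measurableT_comp mtc (measurable_pair1 _).
  over.
rewrite ge0_integralZl//=; last 2 first.
- exact: (measurable_fun_fubini_tonelli_F _ mf2 (fun=> f0 _)).
- by move=> a _; exact: integral_ge0.
rewrite (ge0_integral_affine b c0)/=; last 2 first.
- by move=> a; exact: integral_ge0.
- exact: (measurable_fun_fubini_tonelli_F _ mf2 (fun=> f0 _)).
rewrite ge0_integral_lebesgue_RnS//; last first.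
  exact: measurableT_comp mf (measurable_taffine _ _).
rewrite exprSr EFinM muleA; congr (_ * _); apply: eq_integral => a _.
by apply: eq_integral => x _; rewrite taffine_tcons.
Qed.

End LebesgueRnAffine.

(** * Power laws *)
Section DensityMeasure.
Local Open Scope ereal_scope.
Context d (T : measurableType d) {R : realType}.
Variables (mu : {measure set T -> \bar R}) (h : T -> R).

(** The properties of h are arguments of the measure, so that its measure
    structure can be inferred from the term alone. *)
Definition mdensity of (forall x, (0 <= h x)%R) & measurable_fun setT h :=
  fun A : set T => \int[mu]_(x in A) (h x)%:E.

Variables (h0 : forall x, (0 <= h x)%R) (mh : measurable_fun setT h).

Local Notation m := (mdensity h0 mh).

Let mEh : measurable_fun setT (EFin \o h).
Proof. exact/measurable_EFinP. Qed.

Let m0 : m set0 = 0.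
Proof. exact: integral_set0. Qed.

Let m_ge0 A : 0 <= m A.
Proof. by apply: integral_ge0 => x _; rewrite lee_fin. Qed.

Let m_sigma_additive : semi_sigma_additive m.
Proof.
move=> F mF tF mUF; rewrite /mdensity ge0_integral_bigcup//; last 2 first.
- exact: measurable_funTS.
- by move=> x _; rewrite lee_fin.
by apply: is_cvg_ereal_nneg_natsum_cond => n _ _; exact: m_ge0.
Qed.

HB.instance Definition _ := isMeasure.Build _ _ _ m m0 m_ge0 m_sigma_additive.

End DensityMeasure.

Section PowerLaw.
Local Open Scope ereal_scope.
Context {R : realType}.

(** Finiteness on rays allows subtraction, which gives the values on half-open
    intervals; these generate the sigma-algebra. *)
Lemma measure_eq_rays (m1 m2 : {measure set (measurableTypeR R) -> \bar R}) :
  (forall r, m1 `]-oo, r]%classic = m2 `]-oo, r]%classic) ->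
  (forall r, m1 `]-oo, r]%classic < +oo) ->
  forall A, measurable A -> m1 A = m2 A.
Proof.
move=> m12 fin1.
have moc u v : `]u, v]%classic = `]-oo, v] `\` `]-oo, u] :> set R.
  apply/seteqP; split => x /=; rewrite !in_itv/=.
    by move=> /andP[ux xv]; split => //; apply/negP; rewrite -ltNge.
  by move=> [xv /negP]; rewrite -ltNge => ->.
have fin_oc (m : {measure set (measurableTypeR R) -> \bar R}) u v :
    (forall r, m `]-oo, r]%classic < +oo) -> m `]u, v]%classic < +oo.
  move=> fm; apply: le_lt_trans (fm v); apply: le_measure; rewrite ?inE//.
  by rewrite moc; exact: subDsetl.
move=> A mA.
apply: (@g_sigma_algebra_measure_unique _ R (measurableTypeR R)
  (@ocitv R) _ (fun n => `](- n%:R)%R, (n%:R : R)]%classic)) => //.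
- by move=> _ [[u v] _ <-]; exact: measurable_itv.
- by move=> i; exact: is_ocitv.
- exact: (bigcup_itvT false false).
- exact: ocitvI.
- move=> _ [[u v] _ <-] /=; have [uv|vu] := leP u v; last first.
    by rewrite set_itv_ge ?measure0// bnd_simp -leNgt ltW.
  have fin2 r : m2 `]-oo, r]%classic < +oo by rewrite -m12.
  have D (m : {measure set (measurableTypeR R) -> \bar R}) :
      (forall r, m `]-oo, r]%classic < +oo) ->
      m `]u, v]%classic = m `]-oo, v]%classic - m `]-oo, u]%classic.
    move=> fm; rewrite moc measureD//; last exact: fm.
    by rewrite setIidr//; exact: subset_itvl.
  by rewrite !D// !m12.
- by move=> k; exact: fin_oc.
Qed.

Lemma integral_powS (p : nat) (r : R) : (0 <= r)%R ->
  \int[lebesgue_measure]_(x in `[0%R, r]) (p.+1%:R * x ^+ p)%:E = (r ^+ p.+1)%:E.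
Proof.
rewrite le_eqVlt => /predU1P[<-|r0].
  by rewrite set_itv1 integral_set1 expr0n.
rewrite (@continuous_FTC2 _ (fun x : R => p.+1%:R * x ^+ p)%R
  (fun x : R => x ^+ p.+1)%R)//=.
- by rewrite expr0n/= sube0.
- apply: continuous_subspaceT => x.
  by apply: cvgM; [exact: cvg_cst|exact: exprn_continuous].
- split.
  + by move=> x _; exact: exprn_derivable.
  + by apply: cvg_at_right_filter; exact: exprn_continuous.
  + by apply: cvg_at_left_filter; exact: exprn_continuous.
- by move=> x _; rewrite derive1E exp_derive /= -scaler_nat /GRing.scale/= mulr1.
Qed.

Section weighted.
Context d (T : measurableType d) (mu : {measure set T -> \bar R}).
Variables (phi h : T -> R) (p : nat) (C : R).
Hypotheses (phi0 : forall x, (0 <= phi x)%R) (mphi : measurable_fun setT phi).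
Hypotheses (h0 : forall x, (0 <= h x)%R) (mh : measurable_fun setT h).
Hypothesis law : forall r : R, (0 <= r)%R ->
  \int[mu]_(x in [set x | (phi x <= r)%R]) (h x)%:E = (C * r ^+ p.+1)%:E.

(** The law says that the image under phi of the measure of density h agrees on
    rays with the measure of density C (p + 1) r^p on the half-line. The
    substitution z = r^2 and polar integration in R^n are both instances. *)
Lemma integral_power_law (f : R -> \bar R) :
  (forall r, 0 <= f r) -> measurable_fun setT f ->
  \int[mu]_x (f (phi x) * (h x)%:E) =
  C%:E * \int[lebesgue_measure]_(r in `[0%R, +oo[)
           (f r * (p.+1%:R * r ^+ p)%:E).
Proof.
move=> f0 mf.
have C0 : (0 <= C)%R.
  rewrite -lee_fin -[C]mulr1 -[X in (C * X)%R](expr1n _ p.+1) -law//.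
  by apply: integral_ge0 => x _; rewrite lee_fin.
pose w : R -> R := (fun r => C * (p.+1%:R * r ^+ p) * \1_`[0%R, +oo[ r)%R.
have w0 r : (0 <= w r)%R.
  rewrite /w indicE mem_setE in_itv/= andbT.
  by case: (leP 0%R r) => r0; rewrite ?mulr0// mulr1 !mulr_ge0// exprn_ge0.
have mw : measurable_fun setT w.
  apply: measurable_funM => //; apply: measurable_funM => //.
  by apply: measurable_funM => //; exact: exprn_measurable.
pose mh_phi : {measure set (measurableTypeR R) -> \bar R} :=
  measure_function_pushforward__canonical__measure_function_Measure
    (mdensity mu h0 mh) (mphi : measurable_fun setT (phi : T -> measurableTypeR R)).
pose m2 : {measure set (measurableTypeR R) -> \bar R} :=
  mdensity (@lebesgue_measure R) w0 mw.
have rays r : mh_phi `]-oo, r]%classic = (if (0 <= r)%R then C * r ^+ p.+1 else 0)%R%:E.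
  transitivity (\int[mu]_(x in [set x | (phi x <= r)%R]) (h x)%:E) => //.
  case: ifPn => [/law//|]; rewrite -ltNge => r0.
  rewrite (_ : [set x | _] = set0) ?integral_set0// -subset0 => x /=.
  by rewrite leNgt (lt_le_trans r0).
have E A : measurable A -> mh_phi A = m2 A.
  apply: measure_eq_rays => r; rewrite rays; last by rewrite ltry.
  rewrite /m2 /= /mdensity.
  transitivity (\int[lebesgue_measure]_(x in `[0%R, r]) (C%:E * (p.+1%:R * x ^+ p)%:E)).
    have [r0|r0] := leP 0%R r; last first.
      by rewrite set_itv_ge ?integral_set0// bnd_simp -ltNge.
    rewrite ge0_integralZl ?integral_powS//.
    - by apply/measurable_EFinP/measurable_funTS; apply: measurable_funM => //; exact: exprn_measurable.
    - by move=> x /=; rewrite in_itv/= => /andP[x0 _]; rewrite lee_fin mulr_ge0// exprn_ge0.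
  rewrite [LHS]integral_mkcond [RHS]integral_mkcond.
  apply: eq_integral => x _.
  rewrite !patchE /w indicE !mem_setE !in_itv/= andbT.
  case: (leP x r); rewrite ?andbF// andbT => _.
  by case: (leP 0%R x) => _; rewrite ?mulr1 ?mulr0 -?EFinM.
transitivity (\int[mh_phi]_r f r).
  rewrite (@ge0_integral_pushforward _ _ _ _ _ _
    (mphi : measurable_fun setT (phi : T -> measurableTypeR R))
    (mdensity mu h0 mh) setT f)// preimage_setT.
  rewrite (@ge0_integral_density _ _ _ mu (mdensity mu h0 mh) h (f \o phi))//.
  - by move=> x; exact: f0.
  - exact: (measurableT_comp mf mphi).
rewrite (eq_measure_integral m2); last by move=> A mA _; exact: E.
rewrite (@ge0_integral_density _ _ _ lebesgue_measure m2 w f)//.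
rewrite -ge0_integralZl//; first 1 last.
- apply: emeasurable_funM; first exact: measurable_funTS.
  by apply/measurable_EFinP/measurable_funTS; apply: measurable_funM => //; exact: exprn_measurable.
- move=> x /=; rewrite in_itv/= andbT => x0; rewrite mule_ge0// lee_fin mulr_ge0//.
  exact: exprn_ge0.
rewrite [RHS]integral_mkcond; apply: eq_integral => x _.
rewrite patchE /w indicE !mem_setE !in_itv/= andbT.
case: (leP 0%R x) => _; rewrite ?mulr1 ?mulr0 ?mule0//.
by rewrite [in RHS]muleCA EFinM.
Qed.
End weighted.

End PowerLaw.

(** * The substitution z = r^2 and the Gamma function at half-integers *)
Section SquareSubstitution.
Local Open Scope ereal_scope.
Context {R : realType}.

(** The set of z >= 0 with sqrt z <= r has length r^2: a power law for sqrt. *)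
Lemma integral_sqr_substitution (f : R -> \bar R) :
  (forall z, 0 <= f z) -> measurable_fun setT f ->
  \int[lebesgue_measure]_(z in `[0%R, +oo[) f z =
  \int[lebesgue_measure]_(r in `[0%R, +oo[) (f (r ^+ 2)%R * (2 * r)%:E).
Proof.
move=> f0 mf.
have msqrt : measurable_fun setT (@Num.sqrt R).
  by apply: continuous_measurable_fun; exact: sqrt_continuous.
have law (r : R) : (0 <= r)%R ->
    \int[lebesgue_measure]_(x in [set x | (Num.sqrt x <= r)%R])
      (\1_(`[0%R, +oo[ : set R) x)%:E = (1 * r ^+ 2)%:E.
  move=> r0.
  have mr : measurable [set x : R | (Num.sqrt x <= r)%R].
    by rewrite -[X in measurable X]setTI; exact: measurable_fun_le.
  rewrite integral_indic// mul1r (_ : _ `&` _ = `[0%R, (r ^+ 2)%R]%classic).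
    rewrite [LHS](lebesgue_measure_itv `[0%R, (r ^+ 2)%R])/= lte_fin -EFinD subr0.
    by case: ltP => // r2; congr EFin; apply/eqP; rewrite eq_le sqr_ge0 r2.
  apply/seteqP; split => x /=; rewrite !in_itv/= ?andbT.
    by move=> [x0 xr]; rewrite x0/= -[x]sqr_sqrtr// ler_sqr ?nnegrE ?sqrtr_ge0.
  move=> /andP[x0 xr]; split => //.
  by rewrite -(ger0_norm r0) -sqrtr_sqr ler_wsqrtr.
have mf2 : measurable_fun setT (fun r : R => f (r ^+ 2)%R).
  exact: (measurableT_comp mf (exprn_measurable 2)).
have := @integral_power_law R _ (measurableTypeR R) lebesgue_measure
  (@Num.sqrt R) (\1_(`[0%R, +oo[ : set R)) 1 1 (@sqrtr_ge0 R) msqrt _ _ law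
  _ (fun=> f0 _) mf2.
rewrite mul1e => <-; last 2 first.
- by move=> x; rewrite indicE.
- by [].
rewrite [LHS]integral_mkcond; apply: eq_integral => x _.
rewrite patchE indicE mem_setE in_itv/= andbT; case: (leP 0%R x) => x0.
  by rewrite mule1 sqr_sqrtr.
by rewrite mule0.
Qed.

Lemma powR_half (p : nat) (r : R) : (0 < r)%R ->
  ((r ^+ 2) `^ (p.+1%:R / 2 - 1) * (2 * r) = 2 * r ^+ p)%R.
Proof.
move=> r0; rewrite -powR_mulrn ?ltW// -powRrM.
rewrite mulrCA; congr (_ * _)%R; rewrite -[X in (_ * X)%R]powRr1 ?ltW//.
rewrite -powRD; last by rewrite (gt_eqF r0) implybT.
rewrite -powR_mulrn ?ltW//; congr (_ `^ _)%R.
by rewrite -natr1; field.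
Qed.

Lemma pow_le_fact_expR (p : nat) (r : R) : (0 <= r)%R ->
  (r ^+ p <= p`!%:R * expR r)%R.
Proof.
case: p => [|p] r0; first by rewrite expr0 mul1r -expR0 ler_expR.
have := expR_ge1Dxn p r0; rewrite -ler_pdivrMl ?ltr0n ?fact_gt0// mulrC.
by apply: le_trans; rewrite lerDr.
Qed.


(** With G = exp (- z) this is Gamma ((p + 1) / 2), and with G the density
    generator it is the normalizing integral. The integrands on the half-line
    are compared on r > 0 only: at r = 0, a power of 0 with negative exponent
    is 0 by convention. *)
Lemma integral_powR_half (p : nat) (G : R -> R) :
  (forall z, (0 <= G z)%R) -> measurable_fun setT G ->
  \int[lebesgue_measure]_(z in `[0%R, +oo[)
     (z `^ (p.+1%:R / 2 - 1) * G z)%:E =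
  2%:E * \int[lebesgue_measure]_(r in `[0%R, +oo[) (r ^+ p * G (r ^+ 2))%:E.
Proof.
move=> G0 mG; set a := (_ - 1)%R.
have mG2 : measurable_fun setT (fun r : R => G (r ^+ 2)%R).
  exact: (measurableT_comp mG (exprn_measurable 2)).
have ma : measurable_fun setT (fun z : R => z `^ a * G z)%R.
  by apply: measurable_funM => //; exact: measurable_powR.
have ma2 : measurable_fun setT (fun r : R => (r ^+ 2) `^ a * G (r ^+ 2) * (2 * r))%R.
  apply: measurable_funM; last exact: measurable_funM.
  exact: (measurableT_comp ma (exprn_measurable 2)).
have mr : measurable_fun setT (fun r : R => r ^+ p * G (r ^+ 2))%R.
  by apply: measurable_funM => //; exact: exprn_measurable.
rewrite integral_sqr_substitution; last 2 first.
- by move=> z; rewrite lee_fin mulr_ge0// powR_ge0.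
- exact/measurable_EFinP.
rewrite -[LHS]integral_itv_obnd_cbnd; last first.
  by apply/measurable_EFinP/measurable_funTS.
rewrite -[X in _ * X]integral_itv_obnd_cbnd; last first.
  by apply/measurable_EFinP/measurable_funTS.
rewrite -ge0_integralZl//; last 2 first.
- by apply/measurable_EFinP/measurable_funTS.
- move=> r /=; rewrite in_itv/= andbT => r0.
  by rewrite lee_fin mulr_ge0// exprn_ge0// ltW.
apply: eq_integral => r; rewrite inE/= in_itv/= andbT => r0.
by rewrite -EFinM mulrAC powR_half// -mulrA.
Qed.

Definition gauss_moment (p : nat) : \bar R :=
  \int[lebesgue_measure]_(r in `[0%R, +oo[) (r ^+ p * expR (- r ^+ 2))%:E.

Let mgauss (p : nat) :
  measurable_fun setT (fun r : R => (r ^+ p * expR (- r ^+ 2))%:E).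
Proof.
apply/measurable_EFinP; apply: measurable_funM; first exact: exprn_measurable.
apply: measurableT_comp; first exact: measurable_expR.
by apply: measurableT_comp => //; exact: exprn_measurable.
Qed.

Let gauss_ge0 (p : nat) (r : R) : `[0%R, +oo[%classic r ->
  0 <= (r ^+ p * expR (- r ^+ 2))%:E.
Proof.
by rewrite /= in_itv/= andbT => r0; rewrite lee_fin mulr_ge0 ?expR_ge0 ?exprn_ge0.
Qed.

(** Since r^p <= p! exp r and r - r^2 <= 1 - r, the exponential density
    dominates. *)
Lemma gauss_moment_lty p : gauss_moment p < +oo.
Proof.
pose K : R := (p`!%:R * expR 1)%R.
have K0 : (0 <= K)%R by rewrite mulr_ge0 ?expR_ge0.
apply: (@le_lt_trans _ _ (K%:E * \int[lebesgue_measure]_x (exponential_pdf 1 x)%:E)); last first.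
  by rewrite integral_exponential_pdf// mule1 ltry.
rewrite -ge0_integralZl//; last 2 first.
- by apply/measurable_EFinP; exact: measurable_exponential_pdf.
- by move=> x _; rewrite lee_fin exponential_pdf_ge0.
rewrite /gauss_moment [leLHS]integral_mkcond; apply: ge0_le_integral => //.
- by move=> x _; apply: erestrict_ge0 => y; exact: gauss_ge0.
- apply: (measurable_restrictT _ _).1; first exact: measurable_itv.
  apply: measurable_funTS.
  exact: mgauss.
- apply/measurable_EFinP; apply: measurable_funM => //.
  exact: measurable_exponential_pdf.
move=> r _; rewrite patchE mem_setE in_itv/= andbT; case: (leP 0%R r) => r0; last first.
  by rewrite mule_ge0 ?lee_fin ?exponential_pdf_ge0.
rewrite lee_fin exponential_pdfE// mul1r mulN1r.
apply: (@le_trans _ _ (p`!%:R * expR r * expR (- r ^+ 2))%R).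
  by rewrite ler_wpM2r ?expR_ge0// pow_le_fact_expR.
rewrite /K -!mulrA ler_wpM2l// -!expRD ler_expR.
rewrite -subr_ge0 (_ : _ - _ = (r - 1) ^+ 2)%R ?sqr_ge0//; ring.
Qed.

(** On [1, 2] the integrand is at least exp (- 4), whatever p is. This uniform
    bound replaces the functional equation of Gamma in the proof that the
    Bessel series converges. *)
Lemma gauss_moment_ge p : (expR (- 4))%:E <= gauss_moment p.
Proof.
apply: (@le_trans _ _ (\int[lebesgue_measure]_(r in `[1%R, 2%R]) (cst (expR (- 4))%:E r))).
  rewrite integral_cst//= lebesgue_measure_itv/= lte_fin ltr1n -EFinD.
  by rewrite (_ : 2 - 1 = 1)%R ?mule1//; lra.
apply: (@le_trans _ _ (\int[lebesgue_measure]_(r in `[1%R, 2%R]) (r ^+ p * expR (- r ^+ 2))%:E)).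
  apply: ge0_le_integral => //.
  - by move=> x _; rewrite lee_fin expR_ge0.
  - by apply: measurable_funTS; exact: mgauss.
  move=> r /=; rewrite in_itv/= => /andP[r1 r2]; rewrite lee_fin.
  rewrite -[leLHS]mul1r ler_pM ?expR_ge0// ?exprn_ege1// ler_expR lerN2.
  by rewrite -[leRHS]/(2 * 2)%:R natrM -expr2 ler_sqr ?nnegrE//; lra.
apply: ge0_subset_integral => //.
- by apply: measurable_funTS; exact: mgauss.
- exact: gauss_ge0.
- by move=> r /=; rewrite !in_itv/= andbT => /andP[r1 _]; apply: le_trans r1.
Qed.

Lemma gamma_gauss_moment p :
  2%:E * gauss_moment p = (gamma_fun (p.+1%:R / 2))%:E.
Proof.
rewrite /gauss_moment -(@integral_powR_half p (fun z => expR (- z))); last 2 first.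
- by move=> z; exact: expR_ge0.
- by apply: measurableT_comp => //; exact: measurable_expR.
rewrite /gamma_fun /Rintegral fineK//.
rewrite integral_powR_half; last 2 first.
- by move=> z; exact: expR_ge0.
- by apply: measurableT_comp => //; exact: measurable_expR.
rewrite ge0_fin_numE; last by rewrite mule_ge0//; apply: integral_ge0; exact: gauss_ge0.
by rewrite lte_mul_pinfty// gauss_moment_lty.
Qed.

Lemma gamma_half_ge p : (expR (- 4) <= gamma_fun (p.+1%:R / 2) :> R)%R.
Proof.
rewrite -lee_fin -gamma_gauss_moment; apply: (le_trans (gauss_moment_ge p)).
rewrite -[leLHS]mul1e lee_wpmul2r// ?lee_fin ?ler1n//.
by apply: integral_ge0; exact: gauss_ge0.
Qed.

Lemma gamma_half_gt0 p : (0 < gamma_fun (p.+1%:R / 2) :> R)%R.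
Proof. exact: lt_le_trans (expR_gt0 _) (gamma_half_ge p). Qed.

End SquareSubstitution.

(** * Polar integration by homogeneity *)
Section Polar.
Local Open Scope ereal_scope.
Context {R : realType} (n : nat).

Definition dilate (c : R) (x : n.-tuple R) := taffine c [tuple of nseq n 0%R] x.

Variables (N h : n.-tuple R -> R) (p m : nat).
Hypothesis npm : (n + p = m.+1)%N.
Hypotheses (N0 : forall x, (0 <= N x)%R) (mN : measurable_fun setT N).
Hypothesis NZ : forall (c : R) x, (0 < c)%R -> N (dilate c x) = (c * N x)%R.
Hypotheses (h0 : forall x, (0 <= h x)%R) (mh : measurable_fun setT h).
Hypothesis hZ : forall (c : R) x, (0 < c)%R -> h (dilate c x) = (c ^+ p * h x)%R.

Let I (r : R) := \int[lebesgue_Rn n]_(x in [set x | (N x <= r)%R]) (h x)%:E.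

Hypothesis I1 : I 1%R < +oo.

Let mball (r : R) : measurable [set x | (N x <= r)%R].
Proof. by rewrite -[X in measurable X]setTI; exact: measurable_fun_le. Qed.

Let in_ball x (r : R) : (x \in [set x | (N x <= r)%R]) = (N x <= r)%R.
Proof. by apply/idP/idP => [/set_mem|/mem_set]. Qed.

(** The dilation by c has Jacobian c^n and multiplies h by c^p. *)
Let I_scale (c r : R) : (0 < c)%R -> I (c * r)%R = (c ^+ m.+1)%:E * I r.
Proof.
move=> c0; rewrite /I integral_mkcond (@ge0_integral_taffine R n c [tuple of nseq n 0%R]).
- rewrite -npm exprD EFinM -muleA gtr0_norm//; congr (_ * _).
  rewrite -ge0_integralZl//; last 3 first.
  + by apply/measurable_EFinP; exact: measurable_funTS.
  + by move=> x _; rewrite lee_fin.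
  + by rewrite lee_fin exprn_ge0// ltW.
  rewrite [RHS]integral_mkcond; apply: eq_integral => x _.
  rewrite !patchE -/(dilate c x) !in_ball NZ// ler_pM2l//.
  by case: ifP => // _; rewrite hZ// EFinM.
- by rewrite gt_eqF.
- by move=> x; apply: erestrict_ge0 => y _; rewrite lee_fin.
- by apply: (measurable_restrictT _ _).1 => //; apply/measurable_EFinP; exact: measurable_funTS.
Qed.

Lemma ball_law (r : R) : (0 <= r)%R -> I r = (fine (I 1%R) * r ^+ m.+1)%:E.
Proof.
have I_ge0 s : 0 <= I s by apply: integral_ge0 => x _; rewrite lee_fin.
have I1fin : I 1%R \is a fin_num by rewrite ge0_fin_numE.
rewrite le_eqVlt => /predU1P[<-|r0]; last first.
  by rewrite -[r in LHS]mulr1 I_scale// EFinM fineK// muleC.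
rewrite expr0n mulr0.
have I0fin : I 0%R \is a fin_num.
  rewrite ge0_fin_numE// (le_lt_trans _ I1)//; apply: ge0_subset_integral => //.
  - by apply/measurable_EFinP; exact: measurable_funTS.
  - by move=> x _; rewrite lee_fin.
  - by move=> x /= /le_trans; apply.
(* Dilation by 2 fixes {N <= 0}, so its finite mass y satisfies y = 2^(m+1) y. *)
have := @I_scale 2%R 0%R (ltr0Sn R 1); rewrite mulr0 -(fineK I0fin) -EFinM => -[].
set y := fine _ => /eqP; rewrite -subr_eq0 -{1}[y]mul1r -mulrBl mulf_eq0.
move=> /orP[|/eqP->//]; rewrite subr_eq0 => /eqP E.
have : (1 < 2 ^+ m.+1 :> R)%R by rewrite exprn_egt1// ltr1n.
by rewrite -E ltxx.
Qed.

(** The measure of a ball with respect to the weight h is fixed by its degree of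
    homogeneity, up to the mass of the unit ball. *)
Lemma integral_polar (f : R -> \bar R) :
  (forall r, 0 <= f r) -> measurable_fun setT f ->
  \int[lebesgue_Rn n]_x (f (N x) * (h x)%:E) =
  (fine (I 1%R))%:E * \int[lebesgue_measure]_(r in `[0%R, +oo[)
           (f r * (m.+1%:R * r ^+ m)%:E).
Proof. exact: integral_power_law ball_law f. Qed.

End Polar.

(** * Positive definite forms *)
Section PosDef.
Context {R : realType} (n : nat) (S : 'M[R]_n).
Hypothesis pS : posdefmx S.
Implicit Types u v w y t : 'cV[R]_n.

Definition bilin (A : 'M[R]_n) u v : R := (u^T *m A *m v) 0 0.

Lemma bilinDl A u v w : bilin A (u + v) w = bilin A u w + bilin A v w.
Proof. by rewrite /bilin linearD/= !mulmxDl mxE. Qed.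

Lemma bilinDr A u v w : bilin A u (v + w) = bilin A u v + bilin A u w.
Proof. by rewrite /bilin mulmxDr mxE. Qed.

Lemma bilinZl A c u w : bilin A (c *: u) w = c * bilin A u w.
Proof. by rewrite /bilin linearZ/= -!scalemxAl mxE. Qed.

Lemma bilinZr A c u w : bilin A u (c *: w) = c * bilin A u w.
Proof. by rewrite /bilin -scalemxAr mxE. Qed.

Lemma bilinC A u v : A^T = A -> bilin A u v = bilin A v u.
Proof.
move=> AT; rewrite /bilin -[in LHS](trmxK (u^T *m A *m v)) mxE.
by rewrite !trmx_mul trmxK AT mulmxA.
Qed.

Lemma posdef_ge0 u : 0 <= bilin S u u.
Proof.
have [->|u0] := eqVneq u 0; last exact/ltW/pS.2.
by rewrite /bilin mulmx0 mxE.
Qed.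

Lemma posdef_unitmx : S \in unitmx.
Proof.
rewrite unitmxE unitfE; apply/negP => /det0P[v v0 vS].
have := pS.2 v^T; rewrite trmxK vS mul0mx mxE ltxx => H.
suff : false by []; apply: H; apply: contra v0 => /eqP vT0.
by rewrite -[v]trmxK vT0 trmx0.
Qed.

Lemma bilin_invmx u v : bilin (invmx S) u v = bilin S (invmx S *m u) (invmx S *m v).
Proof.
rewrite /bilin trmx_mul trmx_inv pS.1 -!mulmxA.
by rewrite [S *m _]mulmxA mulmxV ?posdef_unitmx// mul1mx.
Qed.

Lemma invmx_ge0 u : 0 <= bilin (invmx S) u u.
Proof. by rewrite bilin_invmx posdef_ge0. Qed.

(** Cauchy-Schwarz for the form S at the vectors t and S^-1 y. *)
Lemma invmx_cauchy t y :
  ((t^T *m y) 0 0) ^+ 2 <= bilin S t t * bilin (invmx S) y y.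
Proof.
rewrite bilin_invmx; set z := invmx S *m y.
have -> : (t^T *m y) 0 0 = bilin S t z.
  by rewrite /bilin /z -mulmxA mulKVmx ?posdef_unitmx.
have [->|t0] := eqVneq t 0.
  by rewrite /bilin trmx0 !mul0mx mxE expr0n mul0r.
have Tp : 0 < bilin S t t by exact: pS.2.
pose c := bilin S t z / bilin S t t.
have := posdef_ge0 (z + (- c) *: t).
rewrite !bilinDl !bilinDr !bilinZl !bilinZr (bilinC z t pS.1).
rewrite -(pmulr_rge0 _ Tp) -[in X in _ -> X]subr_ge0.
congr (is_true (0 <= _)); rewrite /c; field; exact: lt0r_neq0.
Qed.

(** A translation along S t adds a linear form to the quadratic one: this is
    what computes the Gaussian integral with a linear exponent. *)
Lemma invmx_complete_square s t y :
  bilin (invmx S) (y + (- (s / 2)) *: (S *m t)) (y + (- (s / 2)) *: (S *m t)) =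
  bilin (invmx S) y y - s * (t^T *m y) 0 0 + s ^+ 2 * (bilin S t t / 4).
Proof.
rewrite !bilin_invmx mulmxDr -scalemxAr mulKmx ?posdef_unitmx//.
set z := invmx S *m y.
have -> : (t^T *m y) 0 0 = bilin S t z.
  by rewrite /bilin /z -mulmxA mulKVmx ?posdef_unitmx.
rewrite !bilinDl !bilinDr !bilinZl !bilinZr (bilinC z t pS.1).
by field.
Qed.

End PosDef.

Section Forms.
Context {R : realType} (n : nat).
Implicit Types (A : 'M[R]_n) (t : 'cV[R]_n) (x v : n.-tuple R).

Definition lform t x : R := (t^T *m colv x) 0 0.
Definition qform A x : R := bilin A (colv x) (colv x).

Lemma colv_taffine c v x : colv (taffine c v x) = c *: colv x + colv v.
Proof. by apply/colP => i; rewrite !mxE tnth_mktuple. Qed.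

Lemma colv_dilate c x : colv (dilate c x) = c *: colv x.
Proof.
rewrite colv_taffine -[RHS]addr0; congr (_ + _).
by apply/colP => i; rewrite !mxE tnth_nseq.
Qed.

Lemma measurable_lform t : measurable_fun setT (lform t).
Proof.
rewrite (_ : lform t = fun x => \sum_i (t i 0 * tnth x i)); last first.
  by apply/funext => x; rewrite /lform mxE; apply: eq_bigr => i _; rewrite !mxE.
by apply: measurable_sum => i; apply: measurable_funM => //; exact: measurable_tnth.
Qed.

Lemma measurable_qform A : measurable_fun setT (qform A).
Proof.
rewrite (_ : qform A = fun x =>
    \sum_j (\sum_i (tnth x i * A i j)) * tnth x j); last first.
  apply/funext => x; rewrite /qform /bilin mxE; apply: eq_bigr => j _.
  by rewrite !mxE; congr (_ * _); apply: eq_bigr => i _; rewrite !mxE.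
apply: measurable_sum => j; apply: measurable_funM; last exact: measurable_tnth.
by apply: measurable_sum => i; apply: measurable_funM => //; exact: measurable_tnth.
Qed.

Lemma lformZ t c x : lform t (dilate c x) = c * lform t x.
Proof. by rewrite /lform colv_dilate -scalemxAr mxE. Qed.

Lemma qformZ A c x : qform A (dilate c x) = c ^+ 2 * qform A x.
Proof. by rewrite /qform colv_dilate bilinZl bilinZr mulrA. Qed.

End Forms.

Section Ellipsoid.
Local Open Scope ereal_scope.
Context {R : realType} (n : nat) (S : 'M[R]_n).
Hypothesis pS : posdefmx S.

Definition enorm (x : n.-tuple R) : R := Num.sqrt (qform (invmx S) x).

Lemma measurable_enorm : measurable_fun setT enorm.
Proof.
apply: measurableT_comp; last exact: measurable_qform.
by apply: continuous_measurable_fun; exact: sqrt_continuous.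
Qed.

Lemma enorm_dilate (c : R) x : (0 < c)%R -> enorm (dilate c x) = (c * enorm x)%R.
Proof.
move=> c0; rewrite /enorm qformZ sqrtrM ?sqr_ge0//.
by rewrite sqrtr_sqr gtr0_norm.
Qed.

Lemma lform_enorm t x : (lform t x ^+ 2 <= bilin S t t * enorm x ^+ 2)%R.
Proof.
rewrite /enorm sqr_sqrtr; first exact: invmx_cauchy.
exact: invmx_ge0.
Qed.

(** Cauchy-Schwarz against the basis vectors encloses the ellipsoid in a box of
    half-sides sqrt (S i i). *)
Lemma volume_ellipsoid_lty :
  lebesgue_Rn n [set x | (enorm x <= 1)%R] < +oo.
Proof.
pose b i : R := Num.sqrt (S i i).
pose A (i : 'I_n) : set R := `[(- b i)%R, b i]%classic.
apply: (@le_lt_trans _ _ (lebesgue_Rn n [set x | forall i, A i (tnth x i)])).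
  apply: le_measure; rewrite ?inE.
  - rewrite -[X in measurable X]setTI; apply: measurable_fun_le => //.
    exact: measurable_enorm.
  - rewrite (_ : mkset _ = \bigcap_(i in setT)
      ((fun x : n.-tuple R => tnth x i) @^-1` A i)); last first.
      by apply/seteqP; split=> [x Ax i _|x Ax i]; [exact: Ax|exact: (Ax i Logic.I)].
    apply: fin_bigcap_measurable => [|i _]; first exact: finite_finset.
    rewrite -[X in measurable X]setTI; apply: measurable_tnth => //.
    exact: measurable_itv.
  - move=> x /= x1 i; rewrite /A /= in_itv/= -ler_norml -sqrtr_sqr ler_wsqrtr//.
    have := lform_enorm (delta_mx i 0%R) x.
    have -> : lform (delta_mx i 0%R) x = tnth x i.
      by rewrite /lform trmx_delta -rowE !mxE.
    have -> : bilin S (delta_mx i 0%R) (delta_mx i 0%R) = S i i.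
      by rewrite /bilin trmx_delta -rowE -colE !mxE.
    move=> /le_trans; apply; rewrite -[leRHS]mulr1 ler_wpM2l//.
      have := posdef_ge0 pS (delta_mx i 0%R).
      by rewrite /bilin trmx_delta -rowE -colE !mxE.
    by rewrite exprn_ile1// sqrtr_ge0.
rewrite lebesgue_Rn_box; last by move=> i; exact: measurable_itv.
rewrite -ge0_fin_numE; last by apply: prode_ge0.
apply: (big_ind (fun x : \bar R => x \is a fin_num)) => //.
  by move=> x y; exact: fin_numM.
by move=> i _; rewrite /A lebesgue_measure_itv/=; case: ifP.
Qed.

End Ellipsoid.

(** * Series *)
Section SeriesLemmas.
Context {R : realType}.

Lemma nneseries_cvg (u : R^nat) (l : R) :
  series u @ \oo --> l -> (\sum_(k <oo) (u k)%:E = l%:E)%E.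
Proof.
move=> ul; apply/cvg_lim => //.
rewrite (_ : (fun _ => _) = EFin \o series u); last first.
  by apply/funext => n; rewrite /= sumEFin.
exact: cvg_comp ul _.
Qed.

Lemma cvg_nneseries (u : R^nat) (l : R) : (forall k, 0 <= u k) ->
  (\sum_(k <oo) (u k)%:E = l%:E)%E -> series u @ \oo --> l.
Proof.
move=> u0 ul.
have : ((fun n => \sum_(0 <= k < n) (u k)%:E) @ \oo --> l%:E)%E.
  by rewrite -ul; apply: is_cvg_nneseries => k _ _; rewrite lee_fin.
rewrite (_ : (fun _ => _) = EFin \o series u); last first.
  by apply/funext => n; rewrite /= sumEFin.
by move=> /fine_cvgP[_].
Qed.

Lemma cvg_expR_series (x : R) : series (exp_coeff x) @ \oo --> expR x.
Proof. exact: is_cvg_series_exp_coeff. Qed.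

(** The terms of odd degree cancel in the sum of the series at x and - x, once
    its terms are grouped by two. *)
Lemma cvg_cosh_series (x : R) :
  series (fun k => x ^+ k.*2 / k.*2`!%:R) @ \oo --> (expR x + expR (- x)) / 2.
Proof.
pose u n := (exp_coeff x n + exp_coeff (- x) n) / 2.
have ul : series u @ \oo --> (expR x + expR (- x)) / 2.
  rewrite (_ : series u = fun n =>
      (series (exp_coeff x) n + series (exp_coeff (- x)) n) / 2); last first.
    by apply/funext => n; rewrite /series/= -big_split/= mulr_suml.
  by apply: cvgMl; apply: cvgD; exact: cvg_expR_series.
have := @cvg_series_cvg_series_group _ u 2 (cvgP _ ul) isT.
rewrite (cvg_lim _ ul)//; apply: cvg_trans.
rewrite (_ : (fun k => _) = fun n => (\sum_(n * 2 <= i < n.+1 * 2) u i)%R)//.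
apply/funext => n; rewrite !muln2 doubleS !big_nat_recr ?leqnSn//= big_geq// add0r.
have E i : u i = (x ^+ i + (-1) ^+ i * x ^+ i) / i`!%:R / 2.
  by rewrite mulrDl -exprNn.
rewrite !E -!(signr_odd _ n.*2) -!(signr_odd _ n.*2.+1) [odd n.*2.+1]/= odd_double.
rewrite expr0 expr1 mul1r mulN1r subrr !mul0r addr0.
by rewrite 2!mulrDl -splitr.
Qed.

(** If the coefficients before d k vanish, the vanishing sum gives
    |d k| x^k <= M x^(k+1) for x in ]0, 1], and x tends to 0. *)
Lemma pseries_eq0 (d : R^nat) (M : R) :
  (forall n, \sum_(k < n) `|d k| <= M) ->
  (forall x : R, 0 < x -> x <= 1 -> series (fun k => d k * x ^+ k) @ \oo --> 0) ->
  forall k, d k = 0.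
Proof.
move=> dM d0 k; have [m] := ubnP k; elim: m k => // m IH k; rewrite ltnS => km.
have {IH km}IH j : (j < k)%N -> d j = 0 by move=> jk; apply: IH; exact: leq_trans km.
have M0 : 0 <= M by have := dM 0%N; rewrite big_ord0.
have key (x : R) : 0 < x -> x <= 1 -> `|d k| <= x * M.
  move=> x0 x1; rewrite -(ler_pM2l (exprn_gt0 k x0)) mulrA -exprSr.
  have E : (fun n => series (fun j => d j * x ^+ j) n - d k * x ^+ k) @ \oo -->
      - (d k * x ^+ k).
    by rewrite -[X in _ --> X]add0r; apply: cvgB; [exact: d0|exact: cvg_cst].
  have /cvg_norm E' := E.
  rewrite -[X in X * _](ger0_norm (exprn_ge0 k (ltW x0))) -normrM mulrC -normrN.
  apply: (cvgr_to_le E'); near=> n.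
  have kn : (k < n)%N by near: n; exists k.+1.
  rewrite /series/= big_mkord (bigD1 (Ordinal kn))//= addrAC subrr add0r.
  apply: (le_trans (ler_norm_sum _ _ _)).
  apply: (@le_trans _ _ (\sum_(i < n | i != Ordinal kn) `|d i| * x ^+ k.+1)).
    apply: ler_sum => i ik; rewrite normrM [X in _ * X]ger0_norm ?exprn_ge0 ?(ltW x0)//.
    have [ki|ik'] := ltnP k i; last first.
      by rewrite IH ?normr0 ?mul0r// ltn_neqAle ik'; move: ik; rewrite -val_eqE/= => ->.
    by rewrite ler_wpM2l// -(subnKC ki) exprD ler_piMr ?exprn_ge0 ?exprn_ile1 ?(ltW x0).
  rewrite -mulr_suml mulrC ler_wpM2l ?exprn_ge0 ?(ltW x0)//.
  apply: le_trans (dM n); rewrite [leRHS](bigID (fun i => i != Ordinal kn))/=.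
  by rewrite lerDl sumr_ge0.
apply/eqP; rewrite -normr_le0; apply/ler_addgt0Pr => e e0; rewrite add0r.
pose x := Num.min 1 (e / (M + 1)).
have M1 : 0 < M + 1 by rewrite ltr_wpDl.
have x0 : 0 < x by rewrite lt_min ltr01 divr_gt0.
apply: (le_trans (key _ x0 _)); first by rewrite ge_min lexx.
apply: (@le_trans _ _ (x * (M + 1))); first by rewrite ler_pM2l// lerDl.
by rewrite -ler_pdivlMr// ge_min lexx orbT.
Unshelve. all: by end_near. Qed.

End SeriesLemmas.

(** * The moments of a linear form over an ellipsoid *)
Section AngularMoments.
Local Open Scope ereal_scope.
Context {R : realType} (n : nat) (S : 'M[R]_n.+1) (t : 'cV[R]_n.+1).
Hypothesis pS : posdefmx S.

Local Notation L := (lebesgue_Rn n.+1).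
Local Notation N := (enorm S).
Local Notation l := (lform t).
Local Notation T := (bilin S t t).

(** The factor n + 1 + 2k is the degree of homogeneity, which appears when the
    radial law r^(n + 1 + 2k) is differentiated. *)
Definition angular_moment (k : nat) : R :=
  (fine (\int[L]_(x in [set x | (N x <= 1)%R]) (l x ^+ k.*2)%:E) *
   (n + k.*2).+1%:R)%R.

Lemma even_pow_ge0 (a : R) k : (0 <= a ^+ k.*2)%R.
Proof. by rewrite -mul2n exprM exprn_ge0// sqr_ge0. Qed.

Lemma measurable_lform_pow k : measurable_fun setT (fun x => l x ^+ k)%R.
Proof. exact: measurableT_comp (exprn_measurable k) (measurable_lform t). Qed.

(** The weight l^(2k) is integrable on the ellipsoid because l^2 <= T there. *)
Lemma integral_polar_lform k (f : R -> \bar R) :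
  (forall r, 0 <= f r) -> measurable_fun setT f ->
  \int[L]_x (f (N x) * (l x ^+ k.*2)%:E) =
  (angular_moment k)%:E *
    \int[lebesgue_measure]_(r in `[0%R, +oo[) (f r * (r ^+ (n + k.*2))%:E).
Proof.
move=> f0 mf.
have mN : measurable_fun setT N := measurable_enorm S.
have mB : measurable [set x | (N x <= 1)%R].
  by rewrite -[X in measurable X]setTI; exact: measurable_fun_le.
rewrite (@integral_polar R n.+1 N (fun x => l x ^+ k.*2)%R k.*2 (n + k.*2)).
- rewrite /angular_moment EFinM -muleA; congr (_ * _).
  rewrite -ge0_integralZl//.
  + by apply: eq_integral => r _; rewrite EFinM muleCA.
  + apply: emeasurable_funM; first exact: measurable_funTS.
    by apply/measurable_EFinP/measurable_funTS; exact: exprn_measurable.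
  + move=> r /=; rewrite in_itv/= andbT => r0.
    by rewrite mule_ge0// lee_fin exprn_ge0.
- by rewrite addSn.
- by move=> x; exact: sqrtr_ge0.
- exact: mN.
- by move=> c x c0; exact: enorm_dilate.
- by move=> x; exact: even_pow_ge0.
- exact: measurable_lform_pow.
- by move=> c x _; rewrite lformZ exprMn.
- apply: (@le_lt_trans _ _ (\int[L]_(x in [set x | (N x <= 1)%R]) (cst (T ^+ k)%:E x))).
    apply: ge0_le_integral => //.
    + by move=> x _; rewrite lee_fin even_pow_ge0.
    + by apply/measurable_EFinP/measurable_funTS; exact: measurable_lform_pow.
    + move=> x /= x1; rewrite lee_fin -mul2n exprM lerXn2r ?nnegrE ?sqr_ge0 ?posdef_ge0//.
      apply: (le_trans (lform_enorm pS t x)); rewrite -[leRHS]mulr1.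
      by rewrite ler_wpM2l ?posdef_ge0// exprn_ile1// sqrtr_ge0.
  rewrite integral_cst//= lte_mul_pinfty ?lee_fin ?exprn_ge0 ?posdef_ge0//.
  exact: volume_ellipsoid_lty.
- exact: f0.
- exact: mf.
Qed.

Lemma angular_moment_ge0 k : (0 <= angular_moment k)%R.
Proof.
rewrite mulr_ge0// fine_ge0//; apply: integral_ge0 => x _.
by rewrite lee_fin even_pow_ge0.
Qed.

(* Otherwise unification takes the moments for products. *)
Local Opaque angular_moment.

Let term_ge0 (b r : R) k : (0 <= b)%R ->
  (0 <= b * angular_moment k * r ^+ k.*2)%R.
Proof.
move=> b0; apply: mulr_ge0 (even_pow_ge0 r k).
exact: mulr_ge0 b0 (angular_moment_ge0 k).
Qed.

(** Tonelli: all terms are nonnegative, so sums and integrals commute in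
    [0, +oo], without any condition of convergence. *)
Lemma integral_polar_series (b : R^nat) (f : R -> R) :
  (forall k, (0 <= b k)%R) -> (forall r, (0 <= f r)%R) -> measurable_fun setT f ->
  \int[L]_x ((f (N x))%:E * \sum_(k <oo) (b k * l x ^+ k.*2)%:E) =
  \int[lebesgue_measure]_(r in `[0%R, +oo[)
    ((f r * r ^+ n)%:E *
      \sum_(k <oo) (b k * angular_moment k * r ^+ k.*2)%:E).
Proof.
move=> b0 f0 mf.
have mfN : measurable_fun setT (fun x => f (N x)).
  exact: measurableT_comp mf (measurable_enorm S).
under eq_integral => x _.
  rewrite -nneseriesZl; last first.
    by move=> k _; rewrite lee_fin mulr_ge0// even_pow_ge0.
  over.
rewrite integral_nneseries//; last 2 first.
- move=> k; under eq_fun do rewrite -EFinM.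
  apply/measurable_EFinP; apply: measurable_funM => //.
  by apply: measurable_funM => //; exact: measurable_lform_pow.
- by move=> k x _; rewrite -EFinM lee_fin !mulr_ge0// even_pow_ge0.
under [RHS]eq_integral => r r0.
  rewrite -nneseriesZl; last first.
    by move=> k _; exact: term_ge0.
  over.
rewrite integral_nneseries//; last 2 first.
- move=> k; apply: emeasurable_funM; apply/measurable_EFinP/measurable_funTS.
    by apply: measurable_funM => //; exact: exprn_measurable.
  by apply: measurable_funM => //; exact: exprn_measurable.
- move=> k r /=; rewrite in_itv/= andbT => r0; rewrite -EFinM lee_fin.
  apply: mulr_ge0; last exact: term_ge0.
  by rewrite mulr_ge0// exprn_ge0.
apply: eq_eseriesr => k _.
transitivity (\int[L]_x ((b k * f (N x))%:E * (l x ^+ k.*2)%:E)).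
  by apply: eq_integral => x _; rewrite -!EFinM mulrA [(b k * _)%R]mulrC.
rewrite (@integral_polar_lform k (fun r => (b k * f r)%:E)); last 2 first.
- by move=> r; rewrite lee_fin mulr_ge0.
- by apply/measurable_EFinP; exact: measurable_funM.
rewrite -ge0_integralZl//; last 3 first.
- apply/measurable_EFinP/measurable_funTS; apply: measurable_funM.
    exact: measurable_funM.
  exact: exprn_measurable.
- move=> r /=; rewrite in_itv/= andbT => r0.
  by rewrite -EFinM lee_fin !mulr_ge0// exprn_ge0.
- by rewrite lee_fin angular_moment_ge0.
by apply: eq_integral => r _; rewrite -!EFinM exprD; congr EFin; ring.
Qed.

Lemma integral_polar_fun (f : R -> R) :
  (forall r, (0 <= f r)%R) -> measurable_fun setT f ->
  \int[L]_x (f (N x))%:E =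
  (angular_moment 0)%:E *
    \int[lebesgue_measure]_(r in `[0%R, +oo[) (f r * r ^+ n)%:E.
Proof.
move=> f0 mf; have := @integral_polar_lform 0 (fun r => (f r)%:E).
rewrite addn0 => <-.
- by apply: eq_integral => x _; rewrite double0 expr0 mule1.
- by move=> r; rewrite lee_fin.
- exact/measurable_EFinP.
Qed.

Lemma measurable_gauss : measurable_fun setT (fun r : R => expR (- r ^+ 2)).
Proof.
apply: measurableT_comp; first exact: measurable_expR.
by apply: measurableT_comp => //; exact: exprn_measurable.
Qed.

(** The test function exp (- r^2) turns the radial integral into a Gamma value,
    so that the moments can be recovered from Gaussian integrals. *)
Lemma gauss_polar k :
  \int[L]_x (expR (- N x ^+ 2) * l x ^+ k.*2)%:E =
  (angular_moment k * gamma_fun ((n + k.*2).+1%:R / 2) / 2)%:E.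
Proof.
under eq_integral do rewrite EFinM.
rewrite (@integral_polar_lform k (fun r => (expR (- r ^+ 2))%:E)); last 2 first.
- by move=> r; rewrite lee_fin expR_ge0.
- apply/measurable_EFinP; exact: measurable_gauss.
rewrite -[in RHS]mulrA [in RHS]EFinM; congr (_ * _).
rewrite [in RHS]mulrC EFinM -gamma_gauss_moment muleA -EFinM mulVf// mul1e.
by apply: eq_integral => r _; rewrite -EFinM mulrC.
Qed.

(** Translation by - (s / 2) S t completes the square. *)
Lemma gauss_mgf (s : R) :
  \int[L]_x (expR (- N x ^+ 2) * expR (s * l x))%:E =
  (expR (s ^+ 2 * (T / 4)))%:E * \int[L]_x (expR (- N x ^+ 2))%:E.
Proof.
pose v : n.+1.-tuple R := [tuple (- (s / 2) * (S *m t) i 0)%R | i < n.+1].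
have mexp : measurable_fun setT (fun x => expR (- N x ^+ 2)).
  exact: measurableT_comp measurable_gauss (measurable_enorm S).
rewrite (@ge0_integral_taffine R n.+1 1 v (fun x => (expR (- N x ^+ 2))%:E)).
- rewrite normr1 expr1n mul1e -ge0_integralZl//; last first.
    apply/measurable_EFinP; apply: measurableT_comp mexp _.
    exact: measurable_taffine.
  apply: eq_integral => x _; rewrite -EFinM; congr EFin.
  rewrite -!expRD; congr expR.
  rewrite /enorm !sqr_sqrtr ?invmx_ge0// /qform colv_taffine scale1r.
  have -> : colv v = ((- (s / 2)) *: (S *m t))%R.
    by apply/colP => i; rewrite !mxE tnth_mktuple !mxE.
  rewrite invmx_complete_square// -/(lform t x).
  by ring.
- exact: oner_neq0.
- by move=> x; rewrite lee_fin expR_ge0.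
- exact/measurable_EFinP.
Qed.

(** The mass G of exp (- q), see [gauss_massE], expressed by the moment of
    order 0. *)
Definition gauss_mass : R := (angular_moment 0 * gamma_fun (n.+1%:R / 2) / 2)%R.

Lemma gauss_massE : \int[L]_x (expR (- N x ^+ 2))%:E = gauss_mass%:E.
Proof.
rewrite /gauss_mass; have := gauss_polar 0; rewrite addn0 => <-.
by apply: eq_integral => x _; rewrite double0 expr0 mulr1.
Qed.

(** Averaging over s and - s leaves the even powers of l, a series of
    nonnegative terms. *)
Lemma gauss_cosh (s : R) :
  \int[L]_x ((expR (- N x ^+ 2))%:E *
     \sum_(k <oo) ((s ^+ k.*2 / k.*2`!%:R) * l x ^+ k.*2)%:E) =
  (gauss_mass * expR (s ^+ 2 * (T / 4)))%:E.
Proof.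
have mexp : measurable_fun setT (fun x => expR (- N x ^+ 2)).
  exact: measurableT_comp measurable_gauss (measurable_enorm S).
have ml c : measurable_fun setT (fun x => expR (- N x ^+ 2) * expR (c * l x))%R.
  apply: measurable_funM => //; apply: measurableT_comp; first exact: measurable_expR.
  by apply: measurable_funM => //; exact: measurable_lform.
transitivity (\int[L]_x ((2^-1)%:E * ((expR (- N x ^+ 2) * expR (s * l x))%:E +
    (expR (- N x ^+ 2) * expR (- s * l x))%:E))).
  apply: eq_integral => x _.
  rewrite (@nneseries_cvg _ _ ((expR (s * l x) + expR (- (s * l x))) / 2)%R); last first.
    rewrite (_ : (fun k => _) = (fun k => (s * l x) ^+ k.*2 / k.*2`!%:R)%R).
      exact: cvg_cosh_series.
    by apply/funext => k; rewrite exprMn mulrAC.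
  by rewrite -EFinD -!EFinM mulNr; congr EFin; ring.
rewrite ge0_integralZl//; last 2 first.
- by apply: emeasurable_funD; exact/measurable_EFinP.
- by move=> x _; rewrite adde_ge0// lee_fin mulr_ge0 ?expR_ge0.
rewrite ge0_integralD//; last 2 first.
- exact/measurable_EFinP.
- exact/measurable_EFinP.
rewrite !gauss_mgf sqrrN gauss_massE -(EFinM (expR _)) -EFinD -EFinM.
congr EFin.
by field.
Qed.

Local Notation gam k := (gamma_fun ((n + k.*2).+1%:R / 2) : R).

Let gauss_coef (k : nat) : R := (angular_moment k / k.*2`!%:R * gam k / 2)%R.

Let gauss_coef_ge0 k : (0 <= gauss_coef k)%R.
Proof.
apply: divr_ge0 => //; apply: mulr_ge0 (ltW (gamma_half_gt0 _)).
by apply: divr_ge0 => //; exact: angular_moment_ge0.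
Qed.

Lemma gauss_mass_ge0 : (0 <= gauss_mass)%R.
Proof.
apply: divr_ge0 => //; apply: mulr_ge0 (ltW (gamma_half_gt0 _)).
exact: angular_moment_ge0.
Qed.

(** The left-hand side of [gauss_cosh], integrated term by term. *)
Let gauss_coef_series (s : R) :
  series (fun k => gauss_coef k * (s ^+ 2) ^+ k)%R @ \oo -->
  (gauss_mass * expR (s ^+ 2 * (T / 4)))%R.
Proof.
apply: cvg_nneseries.
  by move=> k; rewrite mulr_ge0// exprn_ge0 ?sqr_ge0.
rewrite -gauss_cosh.
under [RHS]eq_integral => x _.
  rewrite -nneseriesZl; last first.
    move=> k _; rewrite lee_fin; apply: mulr_ge0 (even_pow_ge0 _ k).
    by rewrite divr_ge0// even_pow_ge0.
  over.
have ml k : measurable_fun setT (fun x => expR (- N x ^+ 2) * l x ^+ k)%R.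
  apply: measurable_funM (measurable_lform_pow k).
  exact: measurableT_comp measurable_gauss (measurable_enorm S).
rewrite integral_nneseries//; last 2 first.
- move=> k; apply: emeasurable_funM; apply/measurable_EFinP.
    exact: measurableT_comp measurable_gauss (measurable_enorm S).
  by apply: measurable_funM (measurable_lform_pow _).
- move=> k x _; rewrite -EFinM lee_fin mulr_ge0 ?expR_ge0//.
  by apply: mulr_ge0 (even_pow_ge0 _ k); rewrite divr_ge0// even_pow_ge0.
apply: eq_eseriesr => k _.
transitivity (\int[L]_x ((s ^+ k.*2 / k.*2`!%:R)%:E *
    (expR (- N x ^+ 2) * l x ^+ k.*2)%:E)); last first.
  by apply: eq_integral => x _; rewrite -!EFinM mulrCA.
rewrite ge0_integralZl//; last 3 first.
- exact/measurable_EFinP.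
- by move=> x _; rewrite lee_fin mulr_ge0 ?expR_ge0 ?even_pow_ge0.
- by rewrite lee_fin divr_ge0// even_pow_ge0.
rewrite gauss_polar -EFinM -exprM mul2n /gauss_coef; congr EFin.
by ring.
Qed.

Let angular_coefE k :
  (gauss_coef k = gauss_mass * (T / 4) ^+ k / k`!%:R)%R.
Proof.
pose b k := (gauss_mass * (T / 4) ^+ k / k`!%:R)%R.
have T0 : (0 <= T)%R by exact: posdef_ge0.
have b0 i : (0 <= b i)%R.
  by apply: divr_ge0 => //; apply: (mulr_ge0 gauss_mass_ge0); rewrite exprn_ge0// divr_ge0.
have bl s : series (fun k => b k * (s ^+ 2) ^+ k)%R @ \oo -->
    (gauss_mass * expR (s ^+ 2 * (T / 4)))%R.
  rewrite (_ : series _ = fun m => gauss_mass * series (exp_coeff (s ^+ 2 * (T / 4))) m)%R.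
    apply: cvgMr; exact: cvg_expR_series.
  apply/funext => m; rewrite /series/= mulr_sumr; apply: eq_bigr => i _.
  rewrite /b /exp_coeff/= [((s ^+ 2 * _) ^+ i)%R]exprMn.
  by move: ((T / 4) ^+ i)%R ((s ^+ 2) ^+ i)%R (i`!%:R^-1)%R => u w e; ring.
have bound c (c0 : forall i, (0 <= c i)%R) :
    (series (fun k => c k * (1 ^+ 2) ^+ k) @ \oo -->
    (gauss_mass * expR (1 ^+ 2 * (T / 4))))%R -> forall m,
    (\sum_(k < m) c k <= gauss_mass * expR (1 ^+ 2 * (T / 4)))%R.
  move=> cl m; rewrite -(cvg_lim (@Rhausdorff R) cl).
  have -> : (\sum_(k < m) c k = series (fun k => c k * (1 ^+ 2) ^+ k) m)%R.
    by rewrite /series/= big_mkord; apply: eq_bigr => i _; rewrite expr1n expr1n mulr1.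
  apply: nondecreasing_cvgn_le; last exact: cvgP cl.
  by apply: nondecreasing_series => i _ _; rewrite expr1n expr1n mulr1.
pose M := (gauss_mass * expR (1 ^+ 2 * (T / 4)))%R.
apply/eqP; rewrite -subr_eq0; apply/eqP.
apply: (@pseries_eq0 R (fun k => gauss_coef k - b k)%R (M + M)%R) => [m|x x0 x1].
  apply: (@le_trans _ _ (\sum_(k < m) gauss_coef k + \sum_(k < m) b k)%R).
    rewrite -big_split/=; apply: ler_sum => i _.
    by rewrite (le_trans (ler_normB _ _))// !ger0_norm.
  by apply: lerD; apply: bound.
rewrite -(sqr_sqrtr (ltW x0)) -(subrr (gauss_mass * expR (Num.sqrt x ^+ 2 * (T / 4)))%R).
rewrite (_ : series _ = fun m => series (fun k => gauss_coef k * (Num.sqrt x ^+ 2) ^+ k) m -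
  series (fun k => b k * (Num.sqrt x ^+ 2) ^+ k) m)%R; first exact: cvgB.
apply/funext => m; rewrite /series/= -sumrB; apply: eq_bigr => i _.
by rewrite mulrBl.
Qed.

(** Both [gauss_coef_series] and the exponential series expand
    G exp (s^2 T / 4) in powers of s^2, so their coefficients agree. This is the
    source of the Gamma factors of the Bessel function. *)
Lemma angular_momentE k :
  (angular_moment k / k.*2`!%:R =
   2 * gauss_mass * (T / 4) ^+ k / (k`!%:R * gam k))%R.
Proof.
have g0 : (gam k != 0)%R by rewrite gt_eqF// gamma_half_gt0.
have := angular_coefE k; rewrite /gauss_coef => E.
have -> : (angular_moment k / k.*2`!%:R =
   angular_moment k / k.*2`!%:R * gam k / 2 * (2 / gam k))%R.
  by rewrite -[in RHS]mulrA [(2^-1 * _)%R]mulrA mulVf// mul1r mulfK.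
by rewrite E invfM; ring.
Qed.

End AngularMoments.

(** * The radial kernel *)
Lemma ge0_integrable d (T : measurableType d) (R : realType)
    (mu : {measure set T -> \bar R}) (D : set T) (f : T -> R) :
  measurable D -> measurable_fun D f -> (forall x, D x -> 0 <= f x) ->
  (\int[mu]_(x in D) (f x)%:E < +oo)%E -> mu.-integrable D (EFin \o f).
Proof.
move=> mD mf f0 foo; apply/integrableP; split; first exact/measurable_EFinP.
rewrite (eq_integral (fun x => (f x)%:E))// => x /set_mem Dx.
by rewrite /= ger0_norm// f0.
Qed.

Lemma le_integrable_EFin d (T : measurableType d) (R : realType)
    (mu : {measure set T -> \bar R}) (D : set T) (f g : T -> R) (A : R) :
  measurable D -> measurable_fun D f -> (forall x, D x -> `|f x| <= A * g x) ->
  mu.-integrable D (EFin \o g) -> mu.-integrable D (EFin \o f).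
Proof.
move=> mD mf fg /(integrableZl mD A) ig; apply: le_integrable ig => //.
  exact/measurable_EFinP.
by move=> x Dx; rewrite /= lee_fin (le_trans (fg _ Dx))// ler_norm.
Qed.

Section RadialKernel.
Local Open Scope ereal_scope.
Context {R : realType} (n : nat) (S : 'M[R]_n.+1) (t : 'cV[R]_n.+1).
Hypothesis pS : posdefmx S.

Local Notation L := (lebesgue_Rn n.+1).
Local Notation N := (enorm S).
Local Notation l := (lform t).
Local Notation T := (bilin S t t).

Definition kernel_coef k : R := (angular_moment S t k / k.*2`!%:R)%R.
Local Notation c := kernel_coef.

(** For u^2 = T this is 2 G (r u / 2)^(- nu) J_nu (r u), by
    [besselJ_radial_kernel]. As a power series it also makes sense for u = 0. *)
Definition radial_kernel (r : R) : R :=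
  limn (series (fun k => (-1) ^+ k * (c k * r ^+ k.*2)))%R.

(** The kernel of cosh, as [radial_kernel] is the kernel of cos. *)
Definition abs_kernel (r : R) : R :=
  limn (series (fun k => c k * r ^+ k.*2))%R.

Lemma kernel_coef_ge0 k : (0 <= c k)%R.
Proof. by apply: divr_ge0 => //; exact: angular_moment_ge0. Qed.

Let C : R := (2 * gauss_mass S t * expR 4)%R.

Let C0 : (0 <= C)%R.
Proof. by rewrite /C mulr_ge0 ?expR_ge0// mulr_ge0// gauss_mass_ge0. Qed.

Let kernel_term_ge0 (r : R) k : (0 <= c k * r ^+ k.*2)%R.
Proof. exact: mulr_ge0 (kernel_coef_ge0 k) (even_pow_ge0 r k). Qed.

Let T4_ge0 : (0 <= T / 4)%R. Proof. by rewrite divr_ge0// posdef_ge0. Qed.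

(** Gamma values are bounded below by exp (- 4), so the exponential series
    dominates. *)
Let kernel_term_le (r : R) k :
  (c k * r ^+ k.*2 <= C * exp_coeff (T / 4 * r ^+ 2) k)%R.
Proof.
rewrite /kernel_coef angular_momentE// /exp_coeff/=.
rewrite [((T / 4 * _) ^+ k)%R]exprMn -[((r ^+ 2) ^+ k)%R]exprM mul2n.
have aux (G p f g e w : R) : (0 <= G -> 0 <= p -> 0 <= f -> 0 <= w -> g^-1 <= e ->
    2 * G * p / (f * g) * w <= 2 * G * e * (p * w / f))%R.
  move=> G0 p0 f0 w0 ge.
  have -> : (2 * G * p / (f * g) * w = 2 * G * p * w / f * g^-1)%R by rewrite invfM; ring.
  have -> : (2 * G * e * (p * w / f) = 2 * G * p * w / f * e)%R by ring.
  by apply: ler_wpM2l => //; rewrite divr_ge0// !mulr_ge0.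
apply: aux.
- exact: gauss_mass_ge0.
- by rewrite exprn_ge0.
- by [].
- exact: even_pow_ge0.
- rewrite -[leRHS]invrK -expRN lef_pV2 ?posrE ?expR_gt0 ?gamma_half_gt0//.
  exact: gamma_half_ge.
Qed.

Lemma is_cvg_abs_kernel r : cvgn (series (fun k => c k * r ^+ k.*2)%R).
Proof.
apply: (@series_le_cvg _ _ (fun k => C * exp_coeff (T / 4 * r ^+ 2) k)%R) => //.
- move=> k; apply: mulr_ge0 => //; apply: exp_coeff_ge0.
  by rewrite mulr_ge0// sqr_ge0.
- exact: (is_cvg_seriesZ (k := C) (is_cvg_series_exp_coeff _)).
Qed.

Let normed_kernel_series r :
  [normed series (fun k => (-1) ^+ k * (c k * r ^+ k.*2))%R] =
  series (fun k => c k * r ^+ k.*2)%R.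
Proof.
apply/funext => m; rewrite /series/=; apply: eq_bigr => k _.
by rewrite normrM normrX normrN1 expr1n mul1r ger0_norm.
Qed.

Lemma is_cvg_radial_kernel r :
  cvgn (series (fun k => (-1) ^+ k * (c k * r ^+ k.*2)))%R.
Proof.
by apply: normed_cvg; rewrite normed_kernel_series; exact: is_cvg_abs_kernel.
Qed.

Lemma norm_radial_kernel_le r : (`|radial_kernel r| <= abs_kernel r)%R.
Proof.
rewrite /abs_kernel -normed_kernel_series; apply: lim_series_norm.
by rewrite normed_kernel_series; exact: is_cvg_abs_kernel.
Qed.

Lemma abs_kernel_le (r : R) : (abs_kernel r <= C * expR (T / 4 * r ^+ 2))%R.
Proof.
have -> : (C * expR (T / 4 * r ^+ 2) =
    limn (series (fun k => C * exp_coeff (T / 4 * r ^+ 2) k)))%R.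
  by rewrite [RHS](lim_seriesZ C (is_cvg_series_exp_coeff _)).
apply: lim_series_le; first exact: is_cvg_abs_kernel.
  exact: (is_cvg_seriesZ (k := C) (is_cvg_series_exp_coeff _)).
exact: kernel_term_le.
Qed.

Lemma abs_kernel_ge0 r : (0 <= abs_kernel r)%R.
Proof.
apply: limr_ge; first exact: is_cvg_abs_kernel.
by apply: nearW => m; rewrite sumr_ge0.
Qed.

Lemma measurable_abs_kernel : measurable_fun setT abs_kernel.
Proof.
refine (@measurable_fun_cvg _ (measurableTypeR R) R setT
  (fun m r => series (fun k => c k * r ^+ k.*2)%R m) _ _ _).
- move=> m; apply: measurable_sum => k.
  by apply: measurable_funM => //; exact: exprn_measurable.
- by move=> r _; exact: is_cvg_abs_kernel.
Qed.

Lemma measurable_radial_kernel : measurable_fun setT radial_kernel.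
Proof.
refine (@measurable_fun_cvg _ (measurableTypeR R) R setT
  (fun m r => series (fun k => (-1) ^+ k * (c k * r ^+ k.*2))%R m) _ _ _).
- move=> m; apply: measurable_sum => k; apply: measurable_funM => //.
  by apply: measurable_funM => //; exact: exprn_measurable.
- by move=> r _; exact: is_cvg_radial_kernel.
Qed.

End RadialKernel.

(** * The cosine integral over R^n as a radial integral *)
Section PolarCos.
Local Open Scope ereal_scope.
Context {R : realType} (n : nat) (S : 'M[R]_n.+1) (t : 'cV[R]_n.+1).
Hypothesis pS : posdefmx S.

Local Notation L := (lebesgue_Rn n.+1).
Local Notation N := (enorm S).
Local Notation l := (lform t).
Local Notation c := (kernel_coef S t).
Local Notation K := (radial_kernel S t).
Local Notation H := (abs_kernel S t).
Local Notation ch x := ((expR x + expR (- x)) / 2)%R.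

Let sgn_ge0 k : (0 <= 1 - (-1) ^+ k :> R)%R.
Proof. by rewrite -signr_odd; case: odd; rewrite ?expr1 ?expr0 ?subrr ?opprK. Qed.

Let cosh_series (x : R) :
  \sum_(k <oo) ((k.*2`!%:R)^-1 * x ^+ k.*2)%:E = (ch x)%:E.
Proof.
apply: nneseries_cvg; rewrite (_ : (fun k => _) = (fun k => x ^+ k.*2 / k.*2`!%:R)%R).
  exact: cvg_cosh_series.
by apply/funext => k; rewrite mulrC.
Qed.

Let cosh_sub_cos_series (x : R) :
  \sum_(k <oo) ((1 - (-1) ^+ k) / k.*2`!%:R * x ^+ k.*2)%:E = (ch x - cos x)%:E.
Proof.
apply: nneseries_cvg; rewrite (_ : series _ = fun m =>
    series (fun k => x ^+ k.*2 / k.*2`!%:R) m - series (cos_coeff' x) m)%R.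
  by apply: cvgB; [exact: cvg_cosh_series|exact: cvg_cos_coeff'].
apply/funext => m; rewrite /series/= -sumrB; apply: eq_bigr => k _.
rewrite /cos_coeff' -[((-1) ^ k)%R]/((-1) ^+ k)%R.
by rewrite !mulrBl mul1r mulrC mulrAC.
Qed.

Let abs_kernel_series (r : R) :
  \sum_(k <oo) ((k.*2`!%:R)^-1 * angular_moment S t k * r ^+ k.*2)%:E = (H r)%:E.
Proof.
apply: nneseries_cvg; rewrite (_ : (fun k => _) = (fun k => c k * r ^+ k.*2)%R).
  exact: is_cvg_abs_kernel.
by apply/funext => k; rewrite /kernel_coef [(angular_moment _ _ _ * _)%R]mulrC.
Qed.

Let abs_sub_kernel_series (r : R) :
  \sum_(k <oo) ((1 - (-1) ^+ k) / k.*2`!%:R * angular_moment S t k * r ^+ k.*2)%:E =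
  (H r - K r)%:E.
Proof.
apply: nneseries_cvg; rewrite (_ : series _ = fun m =>
    series (fun k => c k * r ^+ k.*2) m -
    series (fun k => (-1) ^+ k * (c k * r ^+ k.*2)) m)%R.
  by apply: cvgB; [exact: is_cvg_abs_kernel|exact: is_cvg_radial_kernel].
apply/funext => m; rewrite /series/= -sumrB; apply: eq_bigr => k _.
rewrite /kernel_coef; move: (angular_moment S t k) ((-1) ^+ k)%R (r ^+ k.*2)%R => a b e.
by move: (k.*2`!%:R^-1)%R => h; ring.
Qed.

Section bounded.
Variables (f : R -> R) (M : R).
Hypotheses (f0 : forall r, (0 <= f r)%R) (mf : measurable_fun setT f).
Hypothesis fM : forall r, (M < r)%R -> f r = 0%R.
Hypothesis foo :
  \int[lebesgue_measure]_(r in `[0%R, +oo[) (f r * r ^+ n)%:E < +oo.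

Let mfr : measurable_fun (`[0%R, +oo[ : set R) (fun r => f r * r ^+ n)%R.
Proof. by apply: measurable_funTS; apply: measurable_funM => //; exact: exprn_measurable. Qed.

Let mfN : measurable_fun setT (fun x => f (N x)).
Proof. exact: measurableT_comp mf (measurable_enorm S). Qed.

Let fr0 r : `[0%R, +oo[%classic r -> (0 <= f r * r ^+ n)%R.
Proof. by rewrite /= in_itv/= andbT => r0; rewrite mulr_ge0// exprn_ge0. Qed.

Let mch : measurable_fun setT (fun x => ch (l x)).
Proof.
apply: measurable_funM => //; apply: measurable_funD;
  (apply: measurableT_comp; first exact: measurable_expR).
- exact: measurable_lform.
- by apply: measurableT_comp => //; exact: measurable_lform.
Qed.

Let mcos : measurable_fun setT (fun x => cos (l x)).
Proof.
apply: measurableT_comp; last exact: measurable_lform.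
by apply: continuous_measurable_fun; exact: continuous_cos.
Qed.

(** The Taylor coefficients of cosh and of cosh - cos are nonnegative, so
    Tonelli applies to these two functions, and cos is their difference. *)
Let fch : \int[L]_x (f (N x) * ch (l x))%:E =
  \int[lebesgue_measure]_(r in `[0%R, +oo[) (f r * r ^+ n * H r)%:E.
Proof.
transitivity (\int[L]_x ((f (N x))%:E * \sum_(k <oo) ((k.*2`!%:R)^-1 * l x ^+ k.*2)%:E)).
  by apply: eq_integral => x _; rewrite cosh_series EFinM.
rewrite integral_polar_series//.
by apply: eq_integral => r _; rewrite abs_kernel_series EFinM.
Qed.

Let fchc : \int[L]_x (f (N x) * (ch (l x) - cos (l x)))%:E =
  \int[lebesgue_measure]_(r in `[0%R, +oo[) (f r * r ^+ n * (H r - K r))%:E.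
Proof.
transitivity (\int[L]_x ((f (N x))%:E *
    \sum_(k <oo) ((1 - (-1) ^+ k) / k.*2`!%:R * l x ^+ k.*2)%:E)).
  by apply: eq_integral => x _; rewrite cosh_sub_cos_series EFinM.
rewrite integral_polar_series//; last by move=> k; rewrite divr_ge0.
by apply: eq_integral => r _; rewrite abs_sub_kernel_series EFinM.
Qed.

(** The kernel grows at most like exp (T r^2 / 4), which is bounded on the
    support of f. *)
Let fH_integrable : lebesgue_measure.-integrable `[0%R, +oo[
  (EFin \o (fun r => f r * r ^+ n * H r)%R).
Proof.
pose A : R := (2 * gauss_mass S t * expR 4 * expR (bilin S t t / 4 * M ^+ 2))%R.
have A0 : (0 <= A)%R.
  by rewrite /A; apply: mulr_ge0 (expR_ge0 _); apply: mulr_ge0 (expR_ge0 _);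
    apply: mulr_ge0 (gauss_mass_ge0 S t).
have fri := @ge0_integrable _ (measurableTypeR R) R lebesgue_measure
  `[0%R, +oo[%classic _ (measurable_itv _) mfr fr0 foo.
apply: (@le_integrable_EFin _ (measurableTypeR R) R lebesgue_measure _ _ _ A
  (measurable_itv _) _ _ fri).
- apply: measurable_funM => //.
  by apply: measurable_funTS; exact: measurable_abs_kernel.
- move=> r r0.
  have H0 := abs_kernel_ge0 t pS r.
  rewrite ger0_norm; last by rewrite mulr_ge0 ?fr0.
  have [rM|Mr] := leP r M; last by rewrite fM// !mul0r mulr0.
  rewrite [leRHS]mulrC ler_wpM2l ?fr0//.
  apply: (le_trans (abs_kernel_le t pS r)).
  rewrite /A; apply: ler_wpM2l.
    by apply: mulr_ge0 (expR_ge0 _); apply: mulr_ge0 (gauss_mass_ge0 S t).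
  rewrite ler_expR; apply: ler_wpM2l; first by rewrite divr_ge0// posdef_ge0.
  by move: r0; rewrite /= in_itv/= andbT => r0; rewrite lerXn2r ?nnegrE ?(le_trans r0).
Qed.

Lemma bounded_kernel_integrable : lebesgue_measure.-integrable `[0%R, +oo[
  (EFin \o (fun r => f r * r ^+ n * K r)%R).
Proof.
apply: (@le_integrable_EFin _ (measurableTypeR R) R lebesgue_measure _ _ _ 1%R
  (measurable_itv _) _ _ fH_integrable).
- apply: measurable_funM => //.
  by apply: measurable_funTS; exact: measurable_radial_kernel.
- move=> r r0; rewrite mul1r normrM [X in (X * _)%R]ger0_norm ?fr0// ler_wpM2l ?fr0//.
  exact: norm_radial_kernel_le.
Qed.

(** The bounded support makes both integrals of [fch] and [fchc] finite, so that
    they can be subtracted. *)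
Lemma integral_polar_cos_bounded :
  \int[L]_x (f (N x) * cos (l x))%:E =
  \int[lebesgue_measure]_(r in `[0%R, +oo[) (f r * r ^+ n * K r)%:E.
Proof.
have mH : measurable_fun (`[0%R, +oo[ : set R) H.
  by apply: measurable_funTS; exact: measurable_abs_kernel.
have mK : measurable_fun (`[0%R, +oo[ : set R) K.
  by apply: measurable_funTS; exact: measurable_radial_kernel.
have chc0 x : (0 <= ch x - cos x :> R)%R.
  rewrite -lee_fin -cosh_sub_cos_series; apply: nneseries_ge0 => k _ _.
  by rewrite lee_fin mulr_ge0 ?even_pow_ge0// divr_ge0.
have ch0 x : (0 <= ch x :> R)%R by rewrite divr_ge0// addr_ge0 ?expR_ge0.
have HKi : lebesgue_measure.-integrable `[0%R, +oo[
    (EFin \o (fun r => f r * r ^+ n * (H r - K r))%R).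
  rewrite (_ : _ \o _ = fun r => (f r * r ^+ n * H r)%:E - (f r * r ^+ n * K r)%:E); last first.
    by apply/funext => r; rewrite /= -EFinB mulrBr.
  by apply: integrableB => //; exact: bounded_kernel_integrable.
have chi : L.-integrable setT (EFin \o (fun x => f (N x) * ch (l x))%R).
  apply: ge0_integrable => //.
  - exact: measurable_funM.
  - by move=> x _; rewrite mulr_ge0.
  - by rewrite fch; apply: integrable_lty.
have chci : L.-integrable setT (EFin \o (fun x => f (N x) * (ch (l x) - cos (l x)))%R).
  apply: ge0_integrable => //.
  - by apply: measurable_funM => //; exact: measurable_funB.
  - by move=> x _; rewrite mulr_ge0.
  - by rewrite fchc; apply: integrable_lty.
transitivity (\int[L]_x ((f (N x) * ch (l x))%:E - (f (N x) * (ch (l x) - cos (l x)))%:E)).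
  by apply: eq_integral => x _; rewrite -EFinB; congr EFin; ring.
rewrite integralB_EFin// fch fchc -integralB_EFin//.
by apply: eq_integral => r _; rewrite -EFinB; congr EFin; ring.
Qed.

End bounded.

End PolarCos.

(** * The kernel is bounded by its value at 0 *)
Section KernelBound.
Local Open Scope ereal_scope.
Context {R : realType} (n : nat) (S : 'M[R]_n.+1) (t : 'cV[R]_n.+1).
Hypothesis pS : posdefmx S.

Local Notation L := (lebesgue_Rn n.+1).
Local Notation N := (enorm S).
Local Notation l := (lform t).
Local Notation c := (kernel_coef S t).
Local Notation K := (radial_kernel S t).
Local Notation leb := (@lebesgue_measure R).
Local Notation Rp := (`[0%R, +oo[%classic : set R).

Let mcos : measurable_fun setT (fun x => cos (l x)).
Proof.
apply: measurableT_comp; last exact: measurable_lform.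
by apply: continuous_measurable_fun; exact: continuous_cos.
Qed.

Let mK : measurable_fun setT K := measurable_radial_kernel t pS.

Let kernel_coef0 : c 0 = angular_moment S t 0.
Proof. by rewrite /kernel_coef double0 fact0 divr1. Qed.

Let integral_radial (f : R -> R) :
  (forall r, (0 <= f r)%R) -> measurable_fun setT f ->
  \int[L]_x (f (N x))%:E = (c 0)%:E * \int[leb]_(r in Rp) (f r * r ^+ n)%:E.
Proof. by move=> f0 mf; rewrite kernel_coef0; exact: integral_polar_fun. Qed.

Let radial_integrable (f : R -> R) :
  (forall r, (0 <= f r)%R) -> measurable_fun setT f ->
  \int[leb]_(r in Rp) (f r * r ^+ n)%:E < +oo ->
  L.-integrable setT (EFin \o (fun x => f (N x))) /\
  leb.-integrable Rp (EFin \o (fun r => f r * r ^+ n)%R).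
Proof.
move=> f0 mf foo; split.
  apply: ge0_integrable => //.
  - exact: measurableT_comp mf (measurable_enorm S).
  - rewrite integral_radial// lte_mul_pinfty//.
    + by rewrite lee_fin kernel_coef_ge0.
apply: (@ge0_integrable _ (measurableTypeR R)) => //.
- by apply: measurable_funTS; apply: measurable_funM => //; exact: exprn_measurable.
- by move=> r; rewrite /= in_itv/= andbT => r0; rewrite mulr_ge0// exprn_ge0.
Qed.

Let test_set (s : R) (m : nat) : set R :=
  [set r : R | (0 < r)%R && (r <= m%:R)%R && (c 0 < s * K r)%R].

Let measurable_test_set s m : measurable (test_set s m).
Proof.
rewrite (_ : test_set s m = `]0%R, m%:R]%classic `&` [set r | (c 0 < s * K r)%R]).
  apply: measurableI; first exact: measurable_itv.
  rewrite (_ : mkset _ = ~` [set r | (s * K r <= c 0)%R]); last first.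
    by apply/seteqP; split => r /=; rewrite ltNge => /negP.
  apply: measurableC; rewrite -[X in measurable X]setTI.
  by apply: measurable_fun_le => //; exact: measurable_funM.
by apply/seteqP; split => r; rewrite /test_set /= in_itv/= => /andP.
Qed.

(** Let f be the indicator of the set. Then f r^n (s K - c 0) is nonnegative,
    while its integral is that of f(N) (s cos l - 1), which is not positive.
    So it vanishes almost everywhere, although it is positive on the set. *)
Let test_set_negligible s m : (forall x : R, (s * cos x <= 1)%R) ->
  leb.-negligible (test_set s m).
Proof.
move=> scos; pose f : R -> R := \1_(test_set s m).
have f0 r : (0 <= f r)%R by rewrite /f indicE.
have mf : measurable_fun setT f by exact: measurable_indic.
have fM r : (m%:R < r)%R -> f r = 0%R.
  move=> mr; rewrite /f indicE memNset// /test_set /= => /andP[/andP[_]].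
  by rewrite leNgt mr.
have foo : \int[leb]_(r in Rp) (f r * r ^+ n)%:E < +oo.
  apply: (@le_lt_trans _ _ (\int[leb]_(r in `[0%R, m%:R]) (cst (m%:R ^+ n)%:E r))).
    rewrite [leLHS]integral_mkcond [leRHS]integral_mkcond.
    apply: ge0_le_integral => //.
    - move=> r _; apply: erestrict_ge0 => {}r; rewrite /= in_itv/= andbT => r0.
      by rewrite lee_fin mulr_ge0// exprn_ge0.
    - apply: (measurable_restrictT _ _).1; first exact: measurable_itv.
      apply/measurable_EFinP/measurable_funTS; apply: measurable_funM.
        exact: mf.
      exact: exprn_measurable.
    - apply: (measurable_restrictT (cst (m%:R ^+ n)%:E : R -> \bar R)
        (measurable_itv `[0%R, m%:R])).1; exact: measurable_cst.
    - move=> r _; rewrite !patchE !mem_setE !in_itv/= andbT.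
      case: (leP 0%R r) => r0 //=; case: (leP r m%:R%R) => rm.
        rewrite lee_fin -[leRHS]mul1r ler_pM ?exprn_ge0//.
          by rewrite /f indicE; case: (_ \in _).
        by rewrite lerXn2r ?nnegrE.
      by rewrite fM// mul0r.
  rewrite integral_cst//= lebesgue_measure_itv/=; case: ifP => _.
    by rewrite -EFinD -EFinM ltry.
  by rewrite mule0.
have [fNi fri] := radial_integrable f0 mf foo.
have fKi := bounded_kernel_integrable t pS f0 mf fM foo.
have fcosi : L.-integrable setT (EFin \o (fun x => f (N x) * cos (l x))%R).
  apply: (@le_integrable_EFin _ _ _ _ _ _ _ 1%R _ _ _ fNi) => //.
    by apply: measurable_funM => //; exact: measurableT_comp mf (measurable_enorm S).
  move=> x _; rewrite mul1r normrM ger0_norm// ler_piMr// ler_norml.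
  by rewrite cos_geN1 cos_le1.
pose u r : R := (f r * r ^+ n * (s * K r - c 0))%R.
have u0 r : Rp r -> (0 <= u r)%R.
  rewrite /= in_itv/= andbT => r0; rewrite /u /f indicE.
  have [/set_mem|_] := boolP (r \in test_set s m); last by rewrite !mul0r.
  move=> /andP[_ cr]; rewrite mul1r mulr_ge0 ?exprn_ge0// subr_ge0.
  exact: ltW.
have mu_ : measurable_fun Rp u.
  apply: measurable_funTS; apply: measurable_funM.
    by apply: measurable_funM => //; exact: exprn_measurable.
  by apply: measurable_funB => //; exact: measurable_funM.
have intu : \int[leb]_(r in Rp) (u r)%:E <= 0.
  have -> : \int[leb]_(r in Rp) (u r)%:E = \int[leb]_(r in Rp)
      (s%:E * (f r * r ^+ n * K r)%:E - (c 0)%:E * (f r * r ^+ n)%:E).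
    by apply: eq_integral => r _; rewrite -!EFinM -EFinB /u; congr EFin; ring.
  rewrite integralB//=; last 2 first.
  - exact: (integrableZl _ _ fKi).
  - exact: (integrableZl _ _ fri).
  have cosK : \int[leb]_(r in Rp) (f r * r ^+ n * K r)%:E =
      \int[L]_x (f (N x) * cos (l x))%:E.
    by rewrite -(integral_polar_cos_bounded t pS f0 mf fM foo).
  rewrite !integralZl// -integral_radial// cosK.
  rewrite -integralZl// sube_le0; apply: le_integral => //.
    exact: (integrableZl _ _ fcosi).
  move=> x _; rewrite -EFinM lee_fin mulrCA ler_piMr//.
have : leb.-negligible (Rp `&` [set r | u r != 0%R]).
  have mEu : measurable_fun Rp (EFin \o u) by exact/measurable_EFinP.
  have [+ _] := ae_eq_integral_abs leb (measurable_itv _) mEu.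
  have -> : \int[leb]_(r in Rp) `|(EFin \o u) r| = \int[leb]_(r in Rp) (u r)%:E.
    by apply: eq_integral => r /set_mem r0; rewrite /= ger0_norm// u0.
  move=> H; have {}H := H _.
  have : ae_eq leb Rp (EFin \o u) (cst 0).
    apply: H; apply/eqP; rewrite eq_le intu/=.
    by apply: integral_ge0 => r r0; rewrite lee_fin u0.
  apply: negligibleS => r [r0 /= ur] /(_ r0)[] /eqP.
  by rewrite (negbTE ur).
apply: negligibleS => r /andP[/andP[r0 rm] cr]; split.
  by rewrite /= in_itv/= andbT ltW.
rewrite /= /u /f indicE mem_set; last by rewrite /test_set/= r0 rm.
by rewrite mul1r mulf_neq0// ?gt_eqF ?subr_gt0 ?exprn_gt0.
Qed.

(** Up to the factor c 0, K(r) is a mean value of cos l over {N = r}. *)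
Lemma ae_radial_kernel_le :
  {ae leb, forall r, Rp r -> (`|K r| <= c 0)%R}.
Proof.
have neg s : (forall x : R, (s * cos x <= 1)%R) ->
    leb.-negligible (\bigcup_m test_set s m).
  by move=> scos; apply: negligible_bigcup => m; exact: test_set_negligible.
have n1 := neg 1%R (fun x => eq_ind_r (fun y => y <= 1)%R (cos_le1 x) (mul1r _)).
have n2 : leb.-negligible (\bigcup_m test_set (-1) m).
  by apply: neg => x; rewrite mulN1r lerNl cos_geN1.
have n0 : leb.-negligible [set 0%R].
  by apply/negligibleP => //; exact: lebesgue_measure_set1.
apply: negligibleS (negligibleU n0 (negligibleU n1 n2)) => r /=.
move=> /not_implyP[r0 /negP]; rewrite -ltNge => cK.
move: r0; rewrite /= in_itv/= andbT le_eqVlt => /predU1P[<-|r0]; first by left.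
right; have [m _ /(_ m (leqnn m)) /= rm] := nbhs_infty_ger (r : R).
have rm' : (0 < r)%R && (r <= m%:R)%R by rewrite r0.
move: cK; rewrite ltr_normr => /orP[cK|cK]; [left|right]; exists m => //.
  by rewrite /test_set/= mul1r rm'.
by rewrite /test_set/= mulN1r rm'.
Qed.

(** Dominated convergence for the truncations of f to r <= m: the integrals are
    dominated by f(N) in R^n and, by the bound on the kernel, by c 0 f r^n on
    the half-line. *)
Lemma integral_polar_cos (f : R -> R) :
  (forall r, (0 <= f r)%R) -> measurable_fun setT f ->
  \int[leb]_(r in Rp) (f r * r ^+ n)%:E < +oo ->
  leb.-integrable Rp (EFin \o (fun r => f r * r ^+ n * K r)%R) /\
  \int[L]_x (f (N x) * cos (l x))%:E =
    \int[leb]_(r in Rp) (f r * r ^+ n * K r)%:E.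
Proof.
move=> f0 mf foo; have [fNi fri] := radial_integrable f0 mf foo.
have mfN : measurable_fun setT (fun x => f (N x)).
  exact: measurableT_comp mf (measurable_enorm S).
pose g (m : nat) r : R := (f r * \1_(`]-oo, m%:R] : set R) r)%R.
have g0 m r : (0 <= g m r)%R by rewrite mulr_ge0// indicE.
have gf m r : (g m r <= f r)%R by rewrite ler_piMr// indicE; case: (_ \in _).
have mg m : measurable_fun setT (g m).
  by apply: measurable_funM => //; exact: measurable_indic.
have gM m r : (m%:R < r)%R -> g m r = 0%R.
  by move=> mr; rewrite /g indicE mem_setE in_itv/= leNgt mr mulr0.
have goo m : \int[leb]_(r in Rp) (g m r * r ^+ n)%:E < +oo.
  apply: le_lt_trans foo; apply: ge0_le_integral => //.
  - by move=> r; rewrite /= in_itv/= andbT => r0; rewrite lee_fin mulr_ge0// exprn_ge0.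
  - apply/measurable_EFinP/measurable_funTS; apply: measurable_funM; first exact: mg.
    exact: exprn_measurable.
  - apply/measurable_EFinP/measurable_funTS; apply: measurable_funM; first exact: mf.
    exact: exprn_measurable.
  - move=> r; rewrite /= in_itv/= andbT => r0.
    by rewrite lee_fin ler_wpM2r ?exprn_ge0.
have g_cvg r : g ^~ r @ \oo --> f r.
  apply: cvg_near_cst; near=> m.
  rewrite /g indicE mem_setE in_itv/= (_ : (r <= m%:R)%R) ?mulr1//.
  by near: m; exact: nbhs_infty_ger.
have mrn (h : R -> R) : measurable_fun setT h ->
    measurable_fun Rp (fun r => h r * r ^+ n * K r)%R.
  move=> mh; apply: measurable_funTS; apply: measurable_funM; last exact: mK.
  by apply: measurable_funM => //; exact: exprn_measurable.
have [] := @dominated_convergence _ (measurableTypeR R) R leb Rp (measurable_itv _)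
    (fun m r => (g m r * r ^+ n * K r)%:E) (fun r => (f r * r ^+ n * K r)%:E)
    (fun r => (c 0)%:E * (f r * r ^+ n)%:E).
- by move=> m; apply/measurable_EFinP; apply: mrn; exact: mg.
- by apply/measurable_EFinP; apply: mrn; exact: mf.
- apply: aeW => r _; apply: cvg_EFin; first by near=> m.
  by apply: cvgMl; apply: cvgMl; exact: g_cvg.
- exact: (integrableZl _ _ fri).
- move: ae_radial_kernel_le; apply: negligibleS; apply: subsetC => r /= Kc m r0.
  rewrite -EFinM lee_fin normrM mulrC [X in (_ * X <= _)%R]ger0_norm; last first.
    by move: r0; rewrite /= in_itv/= andbT => r0; rewrite mulr_ge0// exprn_ge0.
  apply: ler_pM => //; [|exact: Kc|].
    by move: r0; rewrite /= in_itv/= andbT => r0; rewrite mulr_ge0// exprn_ge0.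
  by move: r0; rewrite /= in_itv/= andbT => r0; rewrite ler_wpM2r ?exprn_ge0.
move=> fKi _ fKcvg; split; first exact: fKi.
have [|||||_ _] := @dominated_convergence _ _ R L setT measurableT
    (fun m x => (g m (N x) * cos (l x))%:E) (fun x => (f (N x) * cos (l x))%:E)
    (fun x => (f (N x))%:E).
- move=> m; apply/measurable_EFinP; apply: measurable_funM => //.
  exact: measurableT_comp (mg m) (measurable_enorm S).
- by apply/measurable_EFinP; exact: measurable_funM.
- apply: aeW => x _; apply: cvg_EFin; first by near=> m.
  by apply: cvgMl; exact: g_cvg.
- exact: fNi.
- apply: aeW => x m _; rewrite abse_EFin lee_fin normrM ger0_norm//.
  rewrite -[leRHS]mulr1; apply: ler_pM => //.
  by rewrite ler_norml cos_geN1 cos_le1.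
move=> fNcvg; have E : (fun m => \int[L]_x (g m (N x) * cos (l x))%:E) =
    (fun m => \int[leb]_(r in Rp) (g m r * r ^+ n * K r)%:E).
  apply/funext => m.
  exact: (integral_polar_cos_bounded t pS (g0 m) (mg m) (gM m) (goo m)).
rewrite -(cvg_lim _ fNcvg)// -(cvg_lim _ fKcvg)//; congr (limn _).
by rewrite -E.
Unshelve. all: by end_near. Qed.

End KernelBound.

(** * Signed integrands *)
Section Signed.
Local Open Scope ereal_scope.

Lemma integral_density d (T : measurableType d) {R : realType}
    (mu nu : {measure set T -> \bar R}) (h : T -> R) (f : T -> \bar R) :
  (forall x, (0 <= h x)%R) -> measurable_fun setT h ->
  (forall A, measurable A -> nu A = \int[mu]_(x in A) (h x)%:E) ->
  measurable_fun setT f ->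
  \int[nu]_x f x = \int[mu]_x (f x * (h x)%:E).
Proof.
move=> h0 mh nuE mf; rewrite integralE [RHS]integralE.
rewrite (ge0_integral_density h0 mh nuE)//; last exact: measurable_funepos.
rewrite (ge0_integral_density h0 mh nuE)//; last exact: measurable_funeneg.
congr (_ - _); apply: eq_integral => x _; rewrite ?funeposE ?funenegE.
  by rewrite maxe_pMl// ?mul0e// lee_fin.
by rewrite maxe_pMl// ?mul0e ?muleN ?mulNe// lee_fin.
Qed.

Lemma integral_taffine {R : realType} n (c : R) (v : n.-tuple R)
    (f : n.-tuple R -> \bar R) : `|c|%R = 1%R -> measurable_fun setT f ->
  \int[lebesgue_Rn n]_x f x = \int[lebesgue_Rn n]_x f (taffine c v x).
Proof.
move=> c1 mf; have c0 : (c != 0)%R by rewrite -normr_gt0 c1.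
rewrite integralE [RHS]integralE.
rewrite (ge0_integral_taffine (f := f^\+) v c0)//; last exact: measurable_funepos.
rewrite (ge0_integral_taffine (f := f^\-) v c0)//; last exact: measurable_funeneg.
rewrite c1 expr1n !mul1e.
by congr (_ - _); apply: eq_integral => x _; rewrite ?funeposE ?funenegE.
Qed.

End Signed.

(** * The kernel is a Bessel function *)
Section Bessel.
Context {R : realType} (n : nat) (S : 'M[R]_n.+1) (t : 'cV[R]_n.+1).
Hypothesis pS : posdefmx S.
Variable u : R.
Hypotheses (u0 : 0 < u) (tSt : bilin S t t = u ^+ 2).

Local Notation nu := ((n.+1%:R - 2) / 2 : R).
Local Notation G := (gauss_mass S t).

(** Termwise, from [angular_momentE]: nu + k + 1 = (n + 1) / 2 + k. *)
Lemma besselJ_radial_kernel (r : R) : G != 0 -> 0 < r ->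
  besselJ nu (r * u) * (2 * G) = (r * u / 2) `^ nu * radial_kernel S t r.
Proof.
move=> G0 r0; have ru0 : 0 < r * u / 2 by rewrite divr_gt0// mulr_gt0.
pose b k : R := (-1) ^+ k / (k`!%:R * gamma_fun (nu + k%:R + 1)) *
  (r * u / 2) `^ (nu + 2 * k%:R).
pose a k : R := (-1) ^+ k * (kernel_coef S t k * r ^+ k.*2).
have ab k : b k * (2 * G) = (r * u / 2) `^ nu * a k.
  rewrite /b /a /kernel_coef angular_momentE// tSt.
  have -> : nu + k%:R + 1 = (n + k.*2).+1%:R / 2.
    have -> : (n + k.*2).+1%:R = n.+1%:R + 2 * k%:R :> R.
      by rewrite -addSn natrD -mul2n natrM.
    by field.
  rewrite powRD; last by rewrite (gt_eqF ru0) implybT.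
  have -> : (r * u / 2) `^ (2 * k%:R) = (u ^+ 2 / 4) ^+ k * r ^+ k.*2.
    rewrite -natrM powR_mulrn ?ltW// mul2n -mul2n !exprM -exprMn.
    by congr (_ ^+ k); field.
  move: ((u ^+ 2 / 4) ^+ k) (r ^+ k.*2) ((r * u / 2) `^ nu) ((-1) ^+ k) G => x y z s g.
  by move: (_^-1)%R => h; ring.
have G2 : 2 * G != 0 by rewrite mulf_neq0.
have aux (x y : R) : x / (2 * G) * y * (2 * G) = x * y by rewrite mulrAC divfK.
have -> : besselJ nu (r * u) = (r * u / 2) `^ nu / (2 * G) * radial_kernel S t r.
  rewrite /besselJ /radial_kernel -/b -/a.
  apply: etrans; last first.
    exact: (lim_seriesZ ((r * u / 2) `^ nu / (2 * G)) (@is_cvg_radial_kernel R n S t pS r)).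
  congr (limn (series _)); apply/funext => k; rewrite -/(b k).
  by apply: (mulIf G2); rewrite ab; apply/esym; exact: aux.
exact: aux.
Qed.

End Bessel.

(** * The characteristic function *)

(** The point 0 is negligible. The integrand of the Bessel formula differs there
    from that of the kernel, by the convention on powers of 0. *)
Lemma eq_pos_integrable {R : realType} (F h : R -> R) :
  (forall r : R, 0 < r -> F r = h r) ->
  (@lebesgue_measure R).-integrable `[0%R, +oo[ (EFin \o h) ->
  (@lebesgue_measure R).-integrable `[0%R, +oo[ (EFin \o F) /\
  (\int[lebesgue_measure]_(r in `[0%R, +oo[) (F r)%:E =
   \int[lebesgue_measure]_(r in `[0%R, +oo[) (h r)%:E)%E.
Proof.
move=> Fh hi; have sub : `]0, +oo[ `<=` (`[0, +oo[ : set R).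
  by move=> r; rewrite /= !in_itv/= !andbT; exact: ltW.
have pos (r : R) : r \in `]0, +oo[%classic -> 0 < r by rewrite inE/= in_itv/= andbT.
have mh : measurable_fun (`[0, +oo[ : set R) h.
  by apply/measurable_EFinP; exact: measurable_int hi.
have mF : measurable_fun (`[0, +oo[ : set R) F.
  apply/measurable_fun_itv_obnd_cbndP.
  apply: (eq_measurable_fun h) => [r /pos/Fh//|].
  exact: measurable_funS mh.
have transfer (k : R -> R) : measurable_fun setT k ->
    (\int[lebesgue_measure]_(r in `[0%R, +oo[) (k (F r))%:E =
     \int[lebesgue_measure]_(r in `[0%R, +oo[) (k (h r))%:E)%E.
  move=> mk; rewrite -integral_itv_obnd_cbnd; last first.
    apply/measurable_EFinP; apply: measurable_funS sub _ => //.
    exact: measurableT_comp.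
  rewrite -[RHS]integral_itv_obnd_cbnd; last first.
    apply/measurable_EFinP; apply: measurable_funS sub _ => //.
    exact: measurableT_comp.
  by apply: eq_integral => r /pos r0; rewrite Fh.
split; last exact: (transfer id).
apply/integrableP; split; first exact/measurable_EFinP.
move/integrableP : hi => [_]; apply: le_lt_trans.
have mn : measurable_fun setT (fun x : R => `|x|) by exact: normr_measurable.
by have := transfer _ mn => /= ->.
Qed.

Section EllipticalCharfun.
Local Open Scope ereal_scope.
Context {R : realType} (n : nat) d (T : measurableType d) (P : probability T R).
Variables (X : {RV P >-> n.+1.-tuple R}) (mu : 'cV[R]_n.+1) (S : 'M[R]_n.+1).
Variable g : R -> R.
Hypothesis hX : elliptical X mu S g.

Local Notation L := (lebesgue_Rn n.+1).
Local Notation N := (enorm S).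
Local Notation leb := (@lebesgue_measure R).
Local Notation Rp := (`[0%R, +oo[%classic : set R).
Local Notation cn := (ell_norm_const n.+1 g).
Local Notation D := (\det S `^ (- 2^-1))%R.

Let pS : posdefmx S. Proof. by case: hX. Qed.

Let g0 z : (0 <= z)%R -> (0 <= g z)%R.
Proof. by case: hX => _ [+ _ _] _; apply. Qed.

Let mgsqr : measurable_fun setT (fun r : R => g (r ^+ 2)%R).
Proof.
have [_ [_ mg _] _] := hX.
apply: (@measurable_comp _ _ _ (measurableTypeR R) (measurableTypeR R)
  (measurableTypeR R) Rp) => //.
by move=> _ [r _ <-]; rewrite /= in_itv/= sqr_ge0.
Qed.

Let I : R := \int[leb]_(z in Rp) (z `^ (n.+1%:R / 2 - 1) * g z)%R.

Let I_spec : (0 < I)%R /\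
  \int[leb]_(r in Rp) (r ^+ n * g (r ^+ 2))%:E = (I / 2)%:E.
Proof.
have [_ [_ mg /andP[I0 Ioo]] _] := hX.
have IE : \int[leb]_(z in Rp) (z `^ (n.+1%:R / 2 - 1) * g z)%:E = I%:E.
  by rewrite /I /Rintegral fineK// ge0_fin_numE// ltW.
split; first by rewrite -lte_fin -IE.
have mG : measurable_fun setT (fun z : R => g `|z|%R).
  apply: (@measurable_comp _ _ _ (measurableTypeR R) (measurableTypeR R)
    (measurableTypeR R) Rp) => //.
  - by move=> _ [r _ <-]; rewrite /= in_itv/= normr_ge0.
have := integral_powR_half n (fun z => g0 (normr_ge0 z)) mG.
have -> : \int[leb]_(z in Rp) (z `^ (n.+1%:R / 2 - 1) * g `|z|)%:E = I%:E.
  rewrite -IE; apply: eq_integral => z; rewrite inE/= in_itv/= andbT => z0.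
  by rewrite ger0_norm.
have -> : \int[leb]_(r in Rp) (r ^+ n * g `|r ^+ 2|)%:E =
    \int[leb]_(r in Rp) (r ^+ n * g (r ^+ 2))%:E.
  by apply: eq_integral => r _; rewrite ger0_norm ?sqr_ge0.
by move=> E; rewrite mulrC EFinM E muleA -EFinM mulVf// mul1e.
Qed.

Let K0 : (0 <= cn * D)%R.
Proof.
rewrite mulr_ge0 ?powR_ge0// /ell_norm_const mulr_ge0//.
  by rewrite divr_ge0 ?powR_ge0// ltW// gamma_half_gt0.
by rewrite invr_ge0 ltW//; case: I_spec.
Qed.

(** The density of X - mu at any point x with N x = r. *)
Definition radial_density (r : R) : R := (cn * D * g (r ^+ 2))%R.
Local Notation f := radial_density.

Let f0 r : (0 <= f r)%R.
Proof. by rewrite mulr_ge0// g0// sqr_ge0. Qed.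

Let mf : measurable_fun setT f.
Proof. exact: measurable_funM. Qed.

Let f_moment : \int[leb]_(r in Rp) (f r * r ^+ n)%:E = (cn * D * (I / 2))%:E.
Proof.
have [_ IE] := I_spec; rewrite EFinM -IE -ge0_integralZl//.
- by apply: eq_integral => r _; rewrite -EFinM -mulrA [(g _ * _)%R]mulrC.
- apply/measurable_EFinP/measurable_funTS; apply: measurable_funM; last exact: mgsqr.
  exact: exprn_measurable.
- move=> r; rewrite /= in_itv/= andbT => r0.
  by rewrite lee_fin mulr_ge0 ?exprn_ge0// g0// sqr_ge0.
Qed.

Let f_lty : \int[leb]_(r in Rp) (f r * r ^+ n)%:E < +oo.
Proof. by rewrite f_moment ltry. Qed.

Let vmu : n.+1.-tuple R := [tuple mu i 0%R | i < n.+1].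

Let density_shift x : ell_density mu S g (colv (taffine 1%R vmu x)) = f (N x).
Proof.
rewrite /ell_density colv_taffine scale1r.
have -> : colv vmu = mu by apply/colP => i; rewrite !mxE tnth_mktuple.
by rewrite addrK /radial_density /enorm sqr_sqrtr// invmx_ge0.
Qed.

Let density_shiftN x : ell_density mu S g (colv x) =
  f (N (taffine 1%R [tuple - mu i 0 | i < n.+1]%R x)).
Proof.
rewrite -density_shift; congr (ell_density mu S g _).
rewrite !colv_taffine !scale1r -addrA -[LHS]addr0; congr (_ + _)%R.
by apply/colP => i; rewrite !mxE !tnth_mktuple addNr.
Qed.

Let density_ge0 x : (0 <= ell_density mu S g (colv x))%R.
Proof. by rewrite density_shiftN. Qed.

Let measurable_density :
  measurable_fun setT (fun x => ell_density mu S g (colv x)).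
Proof.
under eq_fun do rewrite density_shiftN.
apply: (measurableT_comp (measurableT_comp mf (measurable_enorm S))).
exact: measurable_taffine.
Qed.

Let expectation_elliptical (phi : n.+1.-tuple R -> R) :
  measurable_fun setT phi ->
  'E_P[fun w => phi (X w)] =
  \int[L]_x (phi (taffine 1%R vmu x) * f (N x))%:E.
Proof.
move=> mphi; rewrite unlock.
have [_ _ hP] := hX.
transitivity (\int[distribution P X]_x (phi x)%:E).
  rewrite integralE [RHS]integralE.
  have mEphi : measurable_fun setT (EFin \o phi) by exact/measurable_EFinP.
  rewrite ge0_integral_distribution//; last exact: measurable_funepos.
  rewrite ge0_integral_distribution//; last exact: measurable_funeneg.
  by congr (_ - _); apply: eq_integral => w _; rewrite /= ?funeposE ?funenegE.
rewrite (@integral_density _ _ R L (distribution P X) _ _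
  density_ge0 measurable_density hP); last first.
  exact/measurable_EFinP.
rewrite [LHS](@integral_taffine R n.+1 1%R vmu) ?normr1//; last first.
  by apply: emeasurable_funM; exact/measurable_EFinP.
by apply: eq_integral => x _; rewrite density_shift -EFinM.
Qed.

Let f_mass : \int[L]_x (f (N x))%:E = 1.
Proof.
have := @expectation_elliptical (cst 1%R) (measurable_cst _).
rewrite (_ : (fun w : T => _) = cst 1%R :> (T -> R)) // expectation_cst => ->.
by apply: eq_integral => x _; rewrite mul1r.
Qed.

Let fN_integrable : L.-integrable setT (EFin \o (fun x => f (N x))).
Proof.
apply: ge0_integrable => //.
- exact: measurableT_comp mf (measurable_enorm S).
- by rewrite f_mass ltry.
Qed.

Definition cos_moment (t : 'cV[R]_n.+1) : R :=
  fine (\int[L]_x (f (N x) * cos (lform t x))%:E).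

Let radial_bounded_integrable (t : 'cV[R]_n.+1) (h : R -> R) :
  measurable_fun setT h -> (forall a, (`|h a| <= 1)%R) ->
  L.-integrable setT (EFin \o (fun x => f (N x) * h (lform t x))%R).
Proof.
move=> mh h1; apply: (@le_integrable_EFin _ _ _ _ _ _ _ 1%R _ _ _ fN_integrable) => //.
  apply: measurable_funM; first exact: measurableT_comp mf (measurable_enorm S).
  exact: measurableT_comp mh (measurable_lform t).
by move=> x _; rewrite mul1r normrM ger0_norm// ler_piMr.
Qed.


Let cos_integrable t : L.-integrable setT (EFin \o (fun x => f (N x) * cos (lform t x))%R).
Proof.
apply: radial_bounded_integrable => [|a]; last by rewrite ler_norml cos_geN1 cos_le1.
by apply: continuous_measurable_fun; exact: continuous_cos.
Qed.

Let sin_integrable t : L.-integrable setT (EFin \o (fun x => f (N x) * sin (lform t x))%R).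
Proof.
apply: radial_bounded_integrable => [|a]; last by rewrite ler_norml sin_geN1 sin_le1.
by apply: continuous_measurable_fun; exact: continuous_sin.
Qed.

Let cos_momentE t :
  \int[L]_x (f (N x) * cos (lform t x))%:E = (cos_moment t)%:E.
Proof.
rewrite /cos_moment fineK//; apply: integrable_fin_num => //; exact: cos_integrable.
Qed.

(** The reflection x -> - x preserves N and changes the sign of the sine. *)
Let sin_moment0 t : \int[L]_x (f (N x) * sin (lform t x))%:E = 0.
Proof.
set B := LHS.
have Bfin : B \is a fin_num by apply: integrable_fin_num => //; exact: sin_integrable.
have NN x : N (taffine (-1)%R [tuple of nseq n.+1 0%R] x) = N x.
  by rewrite /enorm -/(dilate _ _) qformZ sqrrN expr1n mul1r.
have : B = - B.
  rewrite [LHS](@integral_taffine R n.+1 (-1)%R [tuple of nseq n.+1 0%R]).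
  - rewrite -mulN1e -EFinN /B -integralZl//; last exact: sin_integrable.
    apply: eq_integral => x _; rewrite NN -/(dilate _ _) lformZ mulN1r sinN mulrN.
    by rewrite -EFinM mulN1r.
  - by rewrite normrN1.
  - exact: measurable_int (sin_integrable t).
rewrite -(fineK Bfin) => -[] /eqP; rewrite -addr_eq0 -mulr2n mulrn_eq0/=.
by move=> /eqP ->.
Qed.

Let shift_form t x : (t^T *m colv (taffine 1%R vmu x)) 0%R 0%R =
  (lform t x + (t^T *m mu) 0 0)%R.
Proof.
rewrite colv_taffine scale1r.
have -> : colv vmu = mu by apply/colP => i; rewrite !mxE tnth_mktuple.
by rewrite mulmxDr mxE.
Qed.

Local Open Scope complex_scope.

(** The characteristic function of X - mu is real: its sine part vanishes. *)
Lemma charfun_cos_moment t :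
  charfun X t = (cexp (((t^T *m mu) 0 0)*i) * (cos_moment t)%:C)%R.
Proof.
set m := ((t^T *m mu) 0 0)%R.
have Ecos : 'E_P[fun w => cos ((t^T *m colv (X w)) 0 0)%R] = (cos m * cos_moment t)%:E.
  rewrite (@expectation_elliptical (fun y => cos ((t^T *m colv y) 0 0)%R)); last first.
    apply: measurableT_comp (measurable_lform t).
    by apply: continuous_measurable_fun; exact: continuous_cos.
  transitivity (\int[L]_x ((cos m)%:E * (f (N x) * cos (lform t x))%:E -
      (sin m)%:E * (f (N x) * sin (lform t x))%:E)).
    apply: eq_integral => x _; rewrite shift_form cosD -!EFinM -EFinB; congr EFin.
    by ring.
  rewrite integralB//; last 2 first.
  - exact: (integrableZl _ _ (cos_integrable t)).
  - exact: (integrableZl _ _ (sin_integrable t)).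
  rewrite integralZl//; last exact: cos_integrable.
  rewrite integralZl//; last exact: sin_integrable.
  by rewrite sin_moment0 cos_momentE mule0 sube0 -EFinM.
have Esin : 'E_P[fun w => sin ((t^T *m colv (X w)) 0 0)%R] = (sin m * cos_moment t)%:E.
  rewrite (@expectation_elliptical (fun y => sin ((t^T *m colv y) 0 0)%R)); last first.
    apply: measurableT_comp (measurable_lform t).
    by apply: continuous_measurable_fun; exact: continuous_sin.
  transitivity (\int[L]_x ((sin m)%:E * (f (N x) * cos (lform t x))%:E +
      (cos m)%:E * (f (N x) * sin (lform t x))%:E)).
    apply: eq_integral => x _; rewrite shift_form sinD -!EFinM -EFinD; congr EFin.
    by ring.
  rewrite integralD//; last 2 first.
  - exact: (integrableZl _ _ (cos_integrable t)).
  - exact: (integrableZl _ _ (sin_integrable t)).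
  rewrite integralZl//; last exact: cos_integrable.
  rewrite integralZl//; last exact: sin_integrable.
  by rewrite sin_moment0 cos_momentE mule0 adde0 -EFinM.
rewrite /charfun /cexpectation /cexp /=.
under eq_fun do rewrite expR0 mul1r.
under [X in _ +i* fine ('E_P[X])]eq_fun do rewrite expR0 mul1r.
rewrite Ecos Esin /= expR0 !mul1r.
by apply/eqP; rewrite eq_complex /= !mulr0 subr0 add0r !eqxx.
Qed.

(** The density has mass one. By polar integration its mass is a multiple of the
    moment of order 0, as G is, and the definition of the normalizing constant
    leaves exactly this relation. *)
Lemma gauss_mass_norm t : (D * gauss_mass S t = pi `^ (n.+1%:R / 2))%R.
Proof.
have [I0 _] := I_spec.
have := f_mass; rewrite (integral_polar_fun t pS f0 mf) f_moment -EFinM => -[].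
rewrite /ell_norm_const -/I /gauss_mass.
have p0 : (pi `^ (n.+1%:R / 2) != 0 :> R)%R by rewrite gt_eqF// powR_gt0// pi_gt0.
have I1 : (I != 0)%R by rewrite gt_eqF.
move: (angular_moment S t 0) (gamma_fun (n.+1%:R / 2) : R) (pi `^ (n.+1%:R / 2))%R p0 => a G p p0 E.
transitivity (p * (a * (G / p / I * D * (I / 2))))%R; last by rewrite E mulr1.
by field; rewrite p0 I1.
Qed.


Let gauss_mass_neq0 t : gauss_mass S t != 0%R.
Proof.
have : (pi `^ (n.+1%:R / 2) != 0 :> R)%R by rewrite gt_eqF// powR_gt0// pi_gt0.
by rewrite -(gauss_mass_norm t); apply: contra => /eqP ->; rewrite mulr0.
Qed.

Let integrandE t (u r : R) : (0 < u)%R -> bilin S t t = (u ^+ 2)%R -> (0 < r)%R ->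
  (cn * D * ell_phi_integrand n.+1 g u r =
   (u / 2) `^ ((n.+1%:R - 2) / 2) / (2 * gauss_mass S t) *
   (f r * r ^+ n * radial_kernel S t r))%R.
Proof.
move=> u0 tSt r0; rewrite /ell_phi_integrand /radial_density.
have G2 : (2 * gauss_mass S t != 0)%R by rewrite mulf_neq0.
apply: (mulIf G2).
have E := besselJ_radial_kernel pS u0 tSt (gauss_mass_neq0 t) r0.
have -> : (cn * D * (r `^ (n.+1%:R / 2) * besselJ ((n.+1%:R - 2) / 2) (r * u) * g (r ^+ 2)) *
    (2 * gauss_mass S t) =
  cn * D * g (r ^+ 2) * r `^ (n.+1%:R / 2) *
    (besselJ ((n.+1%:R - 2) / 2) (r * u) * (2 * gauss_mass S t)))%R by ring.
rewrite E -[(r * u / 2)%R]mulrA powRM ?ltW ?divr_gt0//.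
have -> : (r ^+ n = r `^ (n.+1%:R / 2) * r `^ ((n.+1%:R - 2) / 2))%R.
  rewrite -powRD ?(gt_eqF r0) ?implybT// -powR_mulrn ?ltW//; congr (_ `^ _)%R.
  by rewrite -natr1; field.
by rewrite [RHS]mulrAC divfK//; ring.
Qed.

(** The radial formula for the profile of the density. All constants cancel by
    [gauss_mass_norm], with (2 pi)^(m/2) = 2 2^nu pi^(m/2) for m = n + 1. *)
Lemma ell_phi_rhs_cos_moment t (u : R) : (0 < u)%R -> bilin S t t = (u ^+ 2)%R ->
  leb.-integrable Rp (fun r => (ell_phi_integrand n.+1 g u r)%:E) /\
  ell_phi_rhs n.+1 g u = cos_moment t.
Proof.
move=> u0 tSt.
have [fKi fKE] := integral_polar_cos t pS f0 mf f_lty.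
have [I0 _] := I_spec.
have K1 : (0 < cn * D)%R.
  rewrite lt_neqAle K0 andbT eq_sym; apply/eqP => K00.
  have := f_mass; rewrite (integral_polar_fun t pS f0 mf) f_moment K00 mul0r mule0.
  by move=> /esym/eqP; rewrite onee_eq0.
pose q : R := ((u / 2) `^ ((n.+1%:R - 2) / 2) / (2 * gauss_mass S t) / (cn * D))%R.
have aux (k a y : R) : (k != 0 -> a * y = k * (a / k * y))%R.
  by move=> k0; field.
have E r : (0 < r)%R -> ell_phi_integrand n.+1 g u r =
    (q * (f r * r ^+ n * radial_kernel S t r))%R.
  move=> r0; apply: (mulfI (lt0r_neq0 K1)); rewrite (integrandE u0 tSt r0) /q.
  exact: aux (lt0r_neq0 K1).
have qKi : leb.-integrable Rp
    (EFin \o (fun r => q * (f r * r ^+ n * radial_kernel S t r))%R).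
  exact: (integrableZl _ _ fKi).
have [Fi FE] := eq_pos_integrable E qKi.
split; first exact: Fi.
have -> : ell_phi_rhs n.+1 g u = (cn * (2 * pi) `^ (n.+1%:R / 2) *
    u `^ (- ((n.+1%:R - 2) / 2)) * (q * cos_moment t))%R.
  rewrite /ell_phi_rhs; congr (_ * _)%R; rewrite /Rintegral FE.
  have -> : \int[leb]_(r in Rp) (q * (f r * r ^+ n * radial_kernel S t r))%:E =
      \int[leb]_(r in Rp) (q%:E * (f r * r ^+ n * radial_kernel S t r)%:E) by [].
  by rewrite integralZl// -fKE cos_momentE.
have cn0 : (cn != 0)%R.
  by apply/eqP => cn0; move: K1; rewrite cn0 mul0r ltxx.
have D0 : (D != 0)%R.
  by apply/eqP => D0; move: K1; rewrite D0 mulr0 ltxx.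
have two : ((2 * pi) `^ (n.+1%:R / 2) =
    2 * 2 `^ ((n.+1%:R - 2) / 2) * (D * gauss_mass S t))%R.
  rewrite gauss_mass_norm powRM ?pi_ge0//; congr (_ * _)%R.
  have -> : (n.+1%:R / 2 = 1 + (n.+1%:R - 2) / 2 :> R)%R by field.
  by rewrite powRD ?pnatr_eq0 ?implybT// powRr1.
rewrite two [(u `^ (- _))%R]powRN /q powRM ?ltW//.
have -> : (2^-1 `^ ((n.+1%:R - 2) / 2) = (2 `^ ((n.+1%:R - 2) / 2))^-1 :> R)%R.
  by rewrite -powR_inv1// -powRrM mulN1r powRN.
have u1 : (u `^ ((n.+1%:R - 2) / 2) != 0)%R by rewrite gt_eqF// powR_gt0.
have v1 : (2 `^ ((n.+1%:R - 2) / 2) != 0 :> R)%R by rewrite gt_eqF// powR_gt0.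
have G1 := gauss_mass_neq0 t.
move: cn0 D0 u1 v1 G1.
move: (ell_norm_const _ _) (\det S `^ _)%R (u `^ _)%R (2 `^ _)%R (gauss_mass S t) (cos_moment t).
move=> c e v w h m c0 e0 v0 w0 h0; field.
by rewrite c0 e0 v0 w0 h0.
Qed.

Let cos_moment0 : cos_moment 0%R = 1%R.
Proof.
rewrite /cos_moment (_ : \int[L]_x _ = 1)// -f_mass; apply: eq_integral => x _.
by rewrite /lform trmx0 mul0mx mxE cos0 mulr1.
Qed.

(** For u > 0 the vector u e has t'St = u^2: every value of u comes from some t,
    and on such a line the dependence on u is explicit. *)
Let unit_vector : exists e : 'cV[R]_n.+1, bilin S e e = 1%R.
Proof.
pose d0 : 'cV[R]_n.+1 := delta_mx 0%R 0%R.
have d1 : (0 < bilin S d0 d0)%R.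
  apply: pS.2; apply/eqP => /matrixP/(_ 0%R 0%R); rewrite !mxE /=.
  by move/eqP; rewrite oner_eq0.
exists ((Num.sqrt (bilin S d0 d0))^-1 *: d0)%R.
rewrite bilinZl bilinZr mulrA -invfM -expr2 sqr_sqrtr ?ltW//.
by rewrite mulVf// gt_eqF.
Qed.

(** The right-hand side at u is the mean of cos (u l) for the linear form l of a
    unit vector, and cos (u l) tends to 1 boundedly. *)
Lemma ell_phi_rhs_cvg : ell_phi_rhs n.+1 g u @[u --> 0%R^'+] --> (1 : R)%R.
Proof.
have [e e1] := unit_vector; have tSt (u : R) : bilin S (u *: e)%R (u *: e)%R = (u ^+ 2)%R.
  by rewrite bilinZl bilinZr e1 mulr1.
apply/cvg_at_rightP => u [u0 ucvg].
have -> : (fun k => ell_phi_rhs n.+1 g (u k)) = (fun k => cos_moment (u k *: e)%R).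
  apply/funext => k; have [_ ->] := ell_phi_rhs_cos_moment (u0 k) (tSt (u k)).
  by [].
have lZ k x : lform (u k *: e)%R x = (u k * lform e x)%R.
  by rewrite /lform linearZ/= -scalemxAl mxE.
have [] := @dominated_convergence _ _ R L setT measurableT
    (fun k x => (f (N x) * cos (lform (u k *: e)%R x))%:E) (fun x => (f (N x))%:E)
    (fun x => (f (N x))%:E).
- by move=> k; exact: measurable_int (cos_integrable _).
- exact: measurable_int fN_integrable.
- apply: aeW => x _; apply: cvg_EFin; first by near=> k.
  rewrite -[X in _ --> X]mulr1 -(cos0 R); apply: cvgMr.
  apply: (cvg_comp (fun k => lform (u k *: e)%R x) cos); last exact: continuous_cos.
  rewrite (_ : (fun _ => _) = fun k => (u k * lform e x)%R); last first.
    by apply/funext => k; exact: lZ.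
  by rewrite -(mul0r (lform e x)); exact: cvgMl.
- exact: fN_integrable.
- apply: aeW => x k _; rewrite abse_EFin lee_fin normrM ger0_norm// ler_piMr//.
  by rewrite ler_norml cos_geN1 cos_le1.
move=> _ _; rewrite f_mass => /fine_cvg; apply: cvg_trans.
exact: cvg_id.
Unshelve. all: by end_near. Qed.

Local Open Scope complex_scope.

Lemma charfun_elliptical t : charfun X t =
  (cexp (((t^T *m mu) 0 0)*i) * (ell_phi n.+1 g ((t^T *m S *m t) 0 0))%:C)%R.
Proof.
rewrite charfun_cos_moment /ell_phi -[((t^T *m S *m t) 0 0)%R]/(bilin S t t).
congr (_ * _%:C)%R; case: ifPn => [T0|].
  have sT : (0 < Num.sqrt (bilin S t t))%R by rewrite sqrtr_gt0.
  have [|_ ->//] := @ell_phi_rhs_cos_moment t _ sT.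
  by rewrite sqr_sqrtr// ltW.
have [-> _|/pS.2] := eqVneq t 0%R; last by rewrite -/(bilin S t t) => ->.
by rewrite cos_moment0; apply/esym/cvg_lim => //; exact: ell_phi_rhs_cvg.
Qed.

Lemma ell_phi_integrable (u : R) : (0 < u)%R ->
  leb.-integrable Rp (fun r => (ell_phi_integrand n.+1 g u r)%:E).
Proof.
move=> u0; have [e e1] := unit_vector.
have tSt : bilin S (u *: e)%R (u *: e)%R = (u ^+ 2)%R.
  by rewrite bilinZl bilinZr e1 mulr1.
by have [] := ell_phi_rhs_cos_moment u0 tSt.
Qed.

End EllipticalCharfun.

Local Open Scope complex_scope.

Theorem theorem3p1 (R : realType) (n : nat) (hn : (1 <= n)%N)
    (d : measure_display) (T : measurableType d) (P : probability T R)
    (X : {RV P >-> n.-tuple R})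
    (mu : 'cV[R]_n) (S : 'M[R]_n) (g : R -> R)
    (hX : elliptical X mu S g) :
  [/\ (* the integral defining phi (u ^+ 2) converges absolutely *)
      forall u : R, 0 < u ->
        (@lebesgue_measure R).-integrable `[0%R, +oo[
          (fun r => (ell_phi_integrand n g u r)%:E),
      (* the limit defining phi 0 exists *)
      cvg (ell_phi_rhs n g u @[u --> 0^'+]) &
      forall t : 'cV[R]_n,
        charfun X t =
        cexp (((t^T *m mu) 0 0)*i)
        * (ell_phi n g ((t^T *m S *m t) 0 0))%:C].
Proof.
case: n hn X mu S hX => // n _ X mu S hX; split.
- exact: ell_phi_integrable hX.
- by apply/cvg_ex; exists 1; exact: ell_phi_rhs_cvg hX.
- exact: charfun_elliptical hX.
Qed.
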